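(* Let $n\ge 2$ and $d\in\{1,\ldots,n-1\}$, and assume that $d$ divides $n$. The functions $\mu_n(\cdot|e)_{d-g(d,e,n)}$, for $e\in\{d,d+1,\ldots,n-1\}$, are smoothly independent on $\bigcap_{e=d}^{n-1}\mathcal{I}_n(d,e)_{d-g(d,e,n)}$.
   Context: Norms on $\mathbb{R}^n$ and its exterior powers are Euclidean (the standard basis of each exterior power being orthonormal). A subspace of $\mathbb{R}^n$ is rational if it has a basis of vectors with rational coordinates; $\mathcal{R}_n(e)$ is the set of rational subspaces of dimension $e$ of $\mathbb{R}^n$. The height of $B\in\mathcal{R}_n(e)$ is $H(B)=\|X_1\wedge\cdots\wedge X_e\|$ for any $\mathbb{Z}$-basis $X_1,\ldots,X_e$ of $B\cap\mathbb{Z}^n$ (equivalently, the Euclidean norm of a vector of Plücker coordinates of $B$ with coprime integer entries). Put $g(d,e,n)=\max(0,d+e-n)$. For $1\le j\le \min(d,e)-g(d,e,n)$, a subspace $A$ of dimension $d$ of $\mathbb{R}^n$ is $(e,j)$-irrational if $\dim(A\cap B)<j+g(d,e,n)$ for all $B\in\mathcal{R}_n(e)$; $\mathcal{I}_n(d,e)_j$ is the set of all $(e,j)$-irrational subspaces of dimension $d$ of $\mathbb{R}^n$. For nonzero $X,Y\in\mathbb{R}^n$, $\omega(X,Y)=\|X\wedge Y\|/(\|X\|\,\|Y\|)$. For subspaces $A,B$ of dimensions $d,e$, define inductively $\omega_1(A,B)=\min\{\omega(X,Y): X\in A\setminus\{0\},Y\in B\setminus\{0\}\}$, attained at $(X_1,Y_1)$,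 and, for $j<\min(d,e)$, $\omega_{j+1}(A,B)=\min\{\omega(X,Y): X\in A_j\setminus\{0\},Y\in B_j\setminus\{0\}\}$, attained at $(X_{j+1},Y_{j+1})$, where $A_j$ (resp. $B_j$) is the orthogonal complement of $\mathrm{Span}(X_1,\ldots,X_j)$ in $A$ (resp. of $\mathrm{Span}(Y_1,\ldots,Y_j)$ in $B$). Set $\psi_j(A,B)=\omega_{j+g(d,e,n)}(A,B)$. For $d,e\in\{1,\ldots,n-1\}$, $1\le j\le\min(d,e)-g(d,e,n)$ and $A\in\mathcal{I}_n(d,e)_j$, the exponent $\mu_n(A|e)_j\in[0,+\infty]$ is the supremum of the set of $\mu>0$ such that there are infinitely many $B\in\mathcal{R}_n(e)$ with $\psi_j(A,B)\le H(B)^{-\mu}$. For a set $W$ and functions $f_1,\ldots,f_k:W\to\mathbb{R}\cup\{+\infty\}$, we say $f_1,\ldots,f_k$ are smoothly independent on $W$ if there is no (smooth) submersion $h:\mathbb{R}^k\to\mathbb{R}$ such that for all $w\in W$: $(f_1(w),\ldots,f_k(w))\in\mathbb{R}^k\Rightarrow h(f_1(w),\ldots,f_k(w))=0$. *)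

(* Defs.v *)
From HB Require Import structures.
From mathcomp Require Import all_boot all_order all_algebra.
From mathcomp Require Import all_classical all_reals all_analysis.
Set Implicit Arguments.
Unset Strict Implicit.
Unset Printing Implicit Defensive.
Import Order.TTheory GRing.Theory Num.Theory.
Import numFieldNormedType.Exports.
Local Open Scope classical_set_scope.
Local Open Scope ring_scope.

(* The norm carried by 'rV[R]_n in the library is the sup norm, so the
   Euclidean norm is defined here. *)
Definition norm2 (R : realType) (T : finType) (x : T -> R) : R :=
  Num.sqrt (\sum_t x t ^+ 2).

Definition dotv (R : realType) (n : nat) (x y : 'rV[R]_n) : R :=
  \sum_i x 0 i * y 0 i.

(* The e-th exterior power of R^n is represented by coordinates in its
   standard basis, which is indexed by the increasing e-tuples of indices. *)
Definition multi_index (e n : nat) : finType :=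
  {t : e.-tuple 'I_n | sorted ltn (map val t)}.

(* Coordinates of X_1 /\ ... /\ X_e, where the X_i are the rows of X. *)
Definition wedge (R : realType) (e n : nat) (X : 'M[R]_(e, n)) :
    {ffun multi_index e n -> R} :=
  [ffun I => \det (colsub (tnth (val I)) X)].

Definition omega (R : realType) (n : nat) (X Y : 'rV[R]_n) : R :=
  norm2 (wedge (col_mx X Y)) / (norm2 (X 0) * norm2 (Y 0)).

Definition rational_subspace (R : realType) (n : nat) (B : {vspace 'rV[R]_n}) :
    Prop :=
  exists X : seq 'rV[rat]_n, basis_of B (map (map_mx ratr) X).

Definition rational_subspaces (R : realType) (n e : nat) :
    set {vspace 'rV[R]_n} :=
  [set B | rational_subspace B /\ \dim B = e].

(* The rows of X form a Z-basis of the lattice of integer points of B. *)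
Definition is_Zbasis (R : realType) (n e : nat) (B : {vspace 'rV[R]_n})
    (X : 'M[int]_(e, n)) : Prop :=
  (forall i, map_mx intr (row i X) \in B) /\
  (forall x : 'rV[int]_n, map_mx intr x \in B ->
     exists! c : 'rV[int]_e, x = c *m X).

(* The value does not depend on the Z-basis that is chosen. *)
Definition height (R : realType) (n : nat) (B : {vspace 'rV[R]_n}) : R :=
  let X : 'M[int]_(\dim B, n) := xget 0 [set X | is_Zbasis B X] in
  norm2 (wedge (map_mx (intr : int -> R) X)).

(* Subtraction on nat is truncated, so the maximum with 0 is automatic. *)
Definition gdim (d e n : nat) : nat := maxn 0 (d + e - n).

Definition irrational_subspaces (R : realType) (n d e j : nat) :
    set {vspace 'rV[R]_n} :=
  [set A | \dim A = d /\
     forall B, rational_subspaces e B ->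
       (\dim (A :&: B)%VS < j + gdim d e n)%N].

Definition orth_in (R : realType) (n : nat) (A : {vspace 'rV[R]_n})
    (s : seq 'rV[R]_n) : set 'rV[R]_n :=
  [set x | x \in A /\ forall y, y \in << s >>%VS -> dotv x y = 0].

Definition omega_minimizers (R : realType) (n : nat) (S T : set 'rV[R]_n) :
    set ('rV[R]_n * 'rV[R]_n) :=
  let D := (S `\ 0) `*` (T `\ 0) in
  [set p | D p /\ forall q, D q -> omega p.1 p.2 <= omega q.1 q.2].

(* The pairs (X_1, Y_1), ..., (X_j, Y_j) at which the successive minima
   omega_1(A, B), ..., omega_j(A, B) are attained. *)
Fixpoint principal_pairs (R : realType) (n : nat) (A B : {vspace 'rV[R]_n})
    (j : nat) : seq ('rV[R]_n * 'rV[R]_n) :=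
  if j is i.+1 then
    let s := principal_pairs A B i in
    rcons s (xget (0, 0)
      (omega_minimizers (orth_in A (unzip1 s)) (orth_in B (unzip2 s))))
  else [::].

(* Meaningful for 1 <= j <= min (\dim A, \dim B); the value does not depend on
   the minimizers that are chosen. *)
Definition omega_nth (R : realType) (n j : nat) (A B : {vspace 'rV[R]_n}) : R :=
  let p := last (0, 0) (principal_pairs A B j) in omega p.1 p.2.

Definition psi (R : realType) (n j : nat) (A B : {vspace 'rV[R]_n}) : R :=
  omega_nth (j + gdim (\dim A) (\dim B) n) A B.

(* 0 is added because the supremum is taken in [0, +oo], whereas ereal_sup of
   the empty set is -oo. *)
Definition exponent (R : realType) (n e j : nat) (A : {vspace 'rV[R]_n}) :
    \bar R :=
  ereal_sup (0%E |` [set mu%:E | mu in [set mu : R | 0 < mu /\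
    infinite_set [set B | rational_subspaces e B /\
                          psi j A B <= height B `^ (- mu)]]]).

Fixpoint C_class (R : realType) (k m : nat) (h : 'rV[R]_k -> R^o) : Prop :=
  if m is m'.+1 then
    (forall x, differentiable h x) /\
    (forall v, C_class m' (fun x => 'D_v h x))
  else continuous h.

Definition smooth (R : realType) (k : nat) (h : 'rV[R]_k -> R^o) : Prop :=
  forall m, C_class m h.

Definition submersion (R : realType) (k : nat) (h : 'rV[R]_k -> R^o) : Prop :=
  smooth h /\ forall x, set_surj setT setT ('d h x).

Definition smoothly_independent (R : realType) (T : Type) (k : nat)
    (W : set T) (f : 'I_k -> T -> \bar R) : Prop :=
  ~ exists h : 'rV[R]_k -> R^o, submersion h /\
      forall w, W w -> (forall i, f i w \is a fin_num) ->
        h (\row_i fine (f i w)) = 0.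

(* Main.v *)
Require Import Defs.
From mathcomp Require Import all_boot all_order all_algebra fingroup perm.
From mathcomp Require Import all_classical all_reals all_analysis.
From mathcomp Require Import ring lra zify.

(** The exponents can be prescribed freely on an open set. Put N = n - d. There
    is a nonempty open set of vectors (p_1, ..., p_N) such that some subspace A
    of dimension d, contained in no proper rational subspace, has the exponents
    p_1, ..., p_N for e = d, ..., n - 1 ([prescribed_exponents],
    [ratios_region]). A function that vanishes at all vectors of exponents
    vanishes on this open set, so its differential is zero there, and it is not
    a submersion ([submersion_not_locally_zero]).

    Since j = d - g(d,e,n), the number psi_j(A,B) is omega_d(A,B), the sine of
    the largest of the d angles between A and B, and irrationality says that A
    lies in no rational subspace of dimension e. Up to a constant factor,
    omega_d(A,B) is the largest distance to B of a unit vector of A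
    ([omega_last_close], [omega_last_le]). This is the only property of angles
    that the sequel depends on. It rests on the existence of minimizers (by
    compactness) and on their first-order condition, by which a vector of A
    orthogonal to X_1, ..., X_i is also orthogonal to Y_1, ..., Y_i.

    The subspace A is spanned by d - 1 vectors of the canonical basis and by one
    vector xi = (1, xi_1, ..., xi_N, 0, ..., 0), where xi_c is the lacunary sum
    of the 2^(-a_k) over the k >= 1 congruent to c - 1 modulo N ([target]). The
    truncations of xi give integer vectors X_k with first coordinate 2^(a_k), and
    X_(k+1) is a multiple of X_k plus a vector of the canonical basis
    ([truncationS]). For 0 <= s < N and k >= 1, let B_(k,s) ([approx_space]) be
    the rational subspace of dimension e = d + s spanned by X_k, ..., X_(k+s) and
    the same d - 1 basis vectors. Its height is comparable to 2^(a_k), and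
    omega_d(A, B_(k,s)) is comparable to 2^(-a_(k+s+1)).

    Conversely, a rational B that is close enough to A is one of the B_(k,s).
    For this, if an integer vector is at distance less than a constant times
    1/H(B) from B, then it belongs to B: the minors of the matrix obtained by
    adding it to a basis of the integer points of B are integers less than 1 in
    absolute value ([int_point_criterion]). When the a_k grow fast, this forces
    X_k, ..., X_(k+s) to lie in B for a suitable k, and dimensions agree. As
    there are finitely many rational subspaces of bounded height
    ([finite_bounded_height]), the exponent of A for e = d + s is the upper
    limit of a_(k+s+1) / a_k ([exponent_value]).

    Finally a_k is the integer part of alpha_0 ... alpha_(k-1), where the
    sequence alpha has period N, is at least 4 and does not increase on
    0, ..., N - 1. A product of s + 1 consecutive terms is then largest when it
    starts at alpha_0 ([window_le]), so that the exponents are the products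
    alpha_0 ... alpha_s. These products are coordinates on the space of the
    sequences alpha, whence the open set. *)

Set Implicit Arguments.
Unset Strict Implicit.
Unset Printing Implicit Defensive.
Import Order.TTheory GRing.Theory Num.Theory.
Import numFieldNormedType.Exports.

(** * Minors and the rank *)

Section Minors.
Local Open Scope ring_scope.

(** The columns are chosen by an arbitrary map, not by an increasing tuple: this
    is the form in which Laplace expansions and rank arguments produce minors,
    and [minor_le_norm2] brings it back to the coordinates of [wedge]. *)
Definition minor (K : comNzRingType) (e n : nat) (X : 'M[K]_(e, n))
  (f : 'I_e -> 'I_n) : K := \det (colsub f X).

Lemma minor_map (K L : comNzRingType) (g : {rmorphism K -> L}) e n
  (X : 'M[K]_(e, n)) f : minor (map_mx g X) f = g (minor X f).
Proof. by rewrite /minor -det_map_mx; congr (\det _); apply/matrixP => i j; rewrite !mxE. Qed.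

Lemma minor_mulmx (K : comNzRingType) e n (U : 'M[K]_e) (X : 'M[K]_(e, n)) f :
  minor (U *m X) f = \det U * minor X f.
Proof.
rewrite /minor -det_mulmx; congr (\det _); apply/matrixP => i j; rewrite !mxE.
by apply: eq_bigr => l _; rewrite !mxE.
Qed.

Lemma minor_noninj (K : comNzRingType) e n (X : 'M[K]_(e, n)) f :
  ~ injective f -> minor X f = 0.
Proof.
move=> /injectiveP /injectivePn [i [j neq_ij eq_f]].
rewrite /minor -det_tr; apply: (determinant_alternate neq_ij) => l.
by rewrite !mxE eq_f.
Qed.

Lemma row_free_minor (K : fieldType) e n (X : 'M[K]_(e, n)) :
  row_free X <-> exists f, minor X f != 0.
Proof.
split=> [Xfree|[f nz]].
  have Xfull : row_full X^T by rewrite /row_full mxrank_tr.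
  exists (fullrankfun Xfull); have := fullrowsub_unit Xfull.
  rewrite unitmxE unitfE -det_tr; congr (\det _ != 0).
  by apply/matrixP => i j; rewrite !mxE.
have : (colsub f X) \in unitmx by rewrite unitmxE unitfE.
rewrite -row_free_unit -!kermx_eq0 => /eqP ker0.
apply/eqP/row_matrixP => i; rewrite row0.
have /sub_kermxP : (row i (kermx X) <= kermx X)%MS by rewrite row_sub.
move=> kX; apply/eqP; rewrite -submx0 -ker0; apply/sub_kermxP.
have -> : colsub f X = X *m colsub f 1%:M.
  by rewrite mulmx_colsub mulmx1.
by rewrite mulmxA kX mul0mx.
Qed.

Lemma minor_col_mx_eq0 (K : fieldType) e n (x : 'rV[K]_n) (Z : 'M[K]_(e, n)) g :
  (x <= Z)%MS -> minor (col_mx x Z) g = 0.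
Proof.
move=> xZ; apply/eqP/negPn/negP => nz.
have /eqP : row_free (col_mx x Z) by apply/row_free_minor; exists g.
have : (\rank (col_mx x Z) <= e)%N.
  apply: leq_trans (rank_leq_row Z); apply: mxrankS.
  by rewrite col_mx_sub xZ submx_refl.
lia.
Qed.

(** Together with [minor_col_mx], this says that membership in the row space of
    Z depends on the maximal minors of Z only. *)
Lemma submx_minors (K : fieldType) e n (x : 'rV[K]_n) (Z : 'M[K]_(e, n)) :
  row_free Z -> (forall g, minor (col_mx x Z) g = 0) -> (x <= Z)%MS.
Proof.
move=> Zfree m0; apply/negPn/negP => nxZ.
have : row_free (col_mx x Z).
  rewrite /row_free -addsmxE.
  (* x spans a line, which meets the row space of Z trivially. *)
  have rx : \rank x = 1%N.
    have : (\rank x <= 1)%N := rank_leq_row x.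
    case: (posnP (\rank x)) => [/eqP|]; last by lia.
    by rewrite mxrank_eq0 => /eqP x0; move: nxZ; rewrite x0 sub0mx.
  have := mxrank_sum_cap x Z; rewrite rx (eqP Zfree).
  have : (\rank (x :&: Z)%MS < \rank x)%N.
    rewrite ltnNge; apply/negP => h; case/negP: nxZ.
    apply: submx_trans (capmxSr x Z).
    by rewrite -(mxrank_leqif_sup (capmxSl x Z)) eqn_leq h mxrankS ?capmxSl.
  rewrite rx ltnS leqn0 => /eqP ->; rewrite addn0 => ->; by rewrite eqxx.
by case/row_free_minor => g; rewrite m0 eqxx.
Qed.

Lemma minor_col_mx (K : comNzRingType) e n (x : 'rV[K]_n) (Z : 'M[K]_(e, n))
  (g : 'I_(1 + e) -> 'I_n) :
  minor (col_mx x Z) g =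
  \sum_j x 0 (g j) * ((-1) ^+ j * minor Z (g \o lift j)).
Proof.
rewrite /minor (expand_det_row _ (lshift e ord0)); apply: eq_bigr => j _.
rewrite !mxE (unsplitK (inl _)) /cofactor add0n; congr (_ * (_ * \det _)).
apply/matrixP => i l; rewrite !mxE.
have -> : lift (lshift e ord0) i = rshift 1 i by apply/val_inj; rewrite /= /bump.
by rewrite (unsplitK (inr _)).
Qed.

Lemma norm2_ge (R : realType) (T : finType) (x : T -> R) t : `|x t| <= norm2 x.
Proof.
rewrite /norm2 -sqrtr_sqr ler_wsqrtr //.
by rewrite (bigD1 t) //= lerDl sumr_ge0 // => i _; rewrite sqr_ge0.
Qed.

Lemma norm2_ge0 (R : realType) (T : finType) (x : T -> R) : 0 <= norm2 x.
Proof. exact: sqrtr_ge0. Qed.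

Lemma norm2_le (R : realType) (T : finType) (x : T -> R) M :
  (forall t, `|x t| <= M) -> norm2 x <= #|T|%:R * M.
Proof.
move=> xM; case: (pickP [pred t : T | true]) => [t0 _|T0]; last first.
  by rewrite /norm2 big_pred0 // sqrtr0 (@eq_card0 T) ?mul0r.
have M0 : 0 <= M by apply: le_trans (xM t0).
have c1 : (1 : R) <= #|T|%:R by rewrite ler1n; apply/card_gt0P; exists t0.
rewrite /norm2 -[leRHS]ger0_norm ?mulr_ge0 ?ler0n // -sqrtr_sqr ler_wsqrtr //.
apply: (@le_trans _ _ (\sum_(t : T) M ^+ 2)).
  apply: ler_sum => t _; rewrite -(real_normK (num_real (x t))).
  by rewrite lerXn2r // ?nnegrE.
rewrite sumr_const -(mulr_natl (M ^+ 2)) exprMn; apply: ler_wpM2r; first exact: sqr_ge0.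
rewrite expr2.
by rewrite ler_peMl // (le_trans ler01).
Qed.

(** Repeated columns make the minor vanish; otherwise sorting the columns changes
    at most its sign, and gives a coordinate of [wedge]. *)
Lemma minor_le_norm2 (R : realType) e n (X : 'M[R]_(e, n)) f :
  `|minor X f| <= norm2 (wedge X).
Proof.
case: (pselect (injective f)) => [finj|/minor_noninj ->]; last first.
  by rewrite normr0 norm2_ge0.
have card_f : #|[set f i | i in 'I_e]| == e.
  by rewrite card_imset // card_ord.
have szt : size (enum [set f i | i in 'I_e]) == e by rewrite -cardE.
pose t := Tuple szt.
have tsort : sorted ltn (map val t).
  rewrite /= /enum_mem -enumT /= sorted_map.
  apply: sorted_filter; first by move=> x y z; apply: ltn_trans.
  by rewrite -sorted_map val_enum_ord iota_ltn_sorted.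
have fs i : exists j, tnth t j == f i.
  have : f i \in t by rewrite mem_enum; apply: imset_f.
  by case/tnthP => j ->; exists j.
pose s0 i := xchoose (fs i).
have s0E i : tnth t (s0 i) = f i by apply/eqP/(xchooseP (fs i)).
have s0inj : injective s0.
  by move=> i j eqs; apply: finj; rewrite -!s0E eqs.
pose s := perm s0inj.
apply: le_trans (norm2_ge _ (exist _ t tsort : multi_index e n)).
rewrite /wedge ffunE /= /minor.
have -> : colsub f X = col_perm s (colsub (tnth t) X).
  by apply/matrixP => i j; rewrite !mxE permE s0E.
rewrite col_permE det_mulmx det_perm normrM normrX normrN normr1 expr1n.
by rewrite mulr1.
Qed.

End Minors.

(** * Euclidean norm and the sine of an angle *)

Section Euclidean.
Local Open Scope ring_scope.
Variables (R : realType) (n : nat).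
Implicit Types x y z : 'rV[R]_n.

Definition enorm x : R := norm2 (x 0).

Lemma dotvC x y : dotv x y = dotv y x.
Proof. by apply: eq_bigr => i _; rewrite mulrC. Qed.

Lemma dotvDl x y z : dotv (x + y) z = dotv x z + dotv y z.
Proof. by rewrite -big_split; apply: eq_bigr => i _; rewrite mxE mulrDl. Qed.

Lemma dotvZl a x z : dotv (a *: x) z = a * dotv x z.
Proof. by rewrite mulr_sumr; apply: eq_bigr => i _; rewrite mxE mulrA. Qed.

Lemma dotvBl x y z : dotv (x - y) z = dotv x z - dotv y z.
Proof. by rewrite dotvDl -scaleN1r dotvZl mulN1r. Qed.

Lemma dotv0l z : dotv 0 z = 0.
Proof. by rewrite /dotv big1 // => i _; rewrite mxE mul0r. Qed.

Lemma dotv_suml I (r : seq I) (P : pred I) (F : I -> 'rV[R]_n) z :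
  dotv (\sum_(i <- r | P i) F i) z = \sum_(i <- r | P i) dotv (F i) z.
Proof. by elim/big_rec2: _ => [|i u v _ <-]; rewrite ?dotv0l ?dotvDl. Qed.

Lemma enorm_ge0 x : 0 <= enorm x.
Proof. exact: norm2_ge0. Qed.

Lemma enorm_sqr x : enorm x ^+ 2 = dotv x x.
Proof.
rewrite /enorm /norm2 sqr_sqrtr; last by apply: sumr_ge0 => i _; exact: sqr_ge0.
by apply: eq_bigr => i _; rewrite expr2.
Qed.

Lemma coord_le_enorm x i : `|x 0 i| <= enorm x.
Proof. exact: norm2_ge. Qed.

Lemma enorm_eq0 x : (enorm x == 0) = (x == 0).
Proof.
apply/eqP/eqP => [x0|->].
  apply/rowP => i; rewrite mxE; apply/eqP; rewrite -normr_le0 -x0.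
  exact: coord_le_enorm.
have /eqP : enorm 0 ^+ 2 = 0 by rewrite enorm_sqr dotv0l.
by rewrite expf_eq0 => /andP[_ /eqP].
Qed.

Lemma enorm_gt0 x : x != 0 -> 0 < enorm x.
Proof. by rewrite -enorm_eq0 lt_def enorm_ge0 andbT. Qed.

Lemma enormZ a x : enorm (a *: x) = `|a| * enorm x.
Proof.
apply/eqP; rewrite -(eqrXn2 (n := 2)) ?mulr_ge0 ?normr_ge0 ?enorm_ge0 //.
rewrite enorm_sqr exprMn enorm_sqr dotvZl dotvC dotvZl mulrA real_normK ?num_real // -expr2.
Qed.

Lemma minor2 x y (f : 'I_2 -> 'I_n) :
  \det (colsub f (col_mx x y)) = x 0 (f 0) * y 0 (f 1) - x 0 (f 1) * y 0 (f 0).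
Proof.
rewrite -/(minor _ _) minor_col_mx 2!big_ord_recl big_ord0 /minor !det_mx11 !mxE /=.
have -> : lift (0 : 'I_2) 0 = 1 by apply/val_inj.
have -> : lift (1 : 'I_2) 0 = 0 by apply/val_inj.
ring.
Qed.

(** Lagrange's identity. It turns [omega], which is defined from exterior
    products, into a function of scalar products. *)
Lemma lagrange_identity x y :
  norm2 (wedge (col_mx x y)) ^+ 2 = (enorm x * enorm y) ^+ 2 - dotv x y ^+ 2.
Proof.
pose F (p : 'I_n * 'I_n) := (x 0 p.1 * y 0 p.2 - x 0 p.2 * y 0 p.1) ^+ 2.
pose h (I : multi_index 2 n) := (tnth (val I) 0, tnth (val I) 1).
have hinj : injective h.
  move=> I J [h0 h1]; apply/val_inj/eq_from_tnth => i.
  case: (fintype.unliftP 0 i) => [j ->|-> //].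
  by rewrite (ord1 j) (_ : lift _ _ = 1) //; apply/val_inj.
have -> : norm2 (wedge (col_mx x y)) ^+ 2 = \sum_I F (h I).
  rewrite /norm2 sqr_sqrtr; last by apply: sumr_ge0 => I _; exact: sqr_ge0.
  by apply: eq_bigr => I _; rewrite /wedge ffunE minor2.
have -> : \sum_I F (h I) = \sum_(p : 'I_n * 'I_n | (p.1 < p.2)%N) F p.
  transitivity (\sum_(I in [set: multi_index 2 n]%SET) F (h I)).
    by apply: eq_bigl => I; rewrite inE.
  rewrite -(big_imset F) /=; last by move=> I J _ _; apply: hinj.
  apply: eq_bigl => -[i j] /=; apply/imsetP/idP => [[I _ [-> ->]]|ltij].
    case: I => -[[|a [|b [|c s]]] sz] //= srt.
    by move: srt; rewrite andbT !(tnth_nth a).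
  have st : sorted ltn (map val [tuple i; j]) by rewrite /= ltij.
  by exists (exist _ [tuple i; j] st); rewrite ?inE.
have dbl : \sum_p F p = (\sum_(p : 'I_n * 'I_n | (p.1 < p.2)%N) F p) *+ 2.
  rewrite (bigID (fun p : 'I_n * 'I_n => (p.1 < p.2)%N)) /= mulr2n; congr (_ + _).
  rewrite [RHS](reindex_inj (h := fun p => (p.2, p.1))) /=; last by move=> [a b] [c d] [-> ->].
  rewrite big_mkcond [RHS]big_mkcond; apply: eq_bigr => -[i j] _ /=.
  rewrite /F /=; case: (ltngtP i j) => //= [_|/val_inj ->].
    by rewrite -sqrrN opprB.
  by rewrite subrr expr0n.
have : \sum_p F p = ((enorm x * enorm y) ^+ 2 - dotv x y ^+ 2) *+ 2.
  rewrite exprMn !enorm_sqr -(pair_bigA _ (fun i j => F (i, j))) /=.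
  rewrite mulrnBl; transitivity
    (\sum_i \sum_j (x 0 i * x 0 i * (y 0 j * y 0 j)) +
     \sum_i \sum_j (y 0 i * y 0 i * (x 0 j * x 0 j)) -
     (\sum_i \sum_j (x 0 i * y 0 i * (x 0 j * y 0 j))) *+ 2).
    rewrite -sumrMnl -big_split /= -sumrB; apply: eq_bigr => i _.
    rewrite -sumrMnl -big_split /= -sumrB; apply: eq_bigr => j _.
    rewrite /F /=; ring.
  have prodsum (u v : 'I_n -> R) : \sum_i \sum_j (u i * v j) = (\sum_i u i) * (\sum_j v j).
    by rewrite mulr_suml; apply: eq_bigr => i _; rewrite mulr_sumr.
  rewrite !prodsum /dotv expr2; ring.
by rewrite dbl !mulr2n => H; lra.
Qed.

Lemma dotv_sqr_le x y : dotv x y ^+ 2 <= (enorm x * enorm y) ^+ 2.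
Proof. by rewrite -subr_ge0 -lagrange_identity sqr_ge0. Qed.

Lemma dotv_le x y : `|dotv x y| <= enorm x * enorm y.
Proof.
rewrite -(ler_pXn2r (isT : (0 < 2)%N)) ?nnegrE ?mulr_ge0 ?enorm_ge0 //.
by rewrite real_normK ?num_real // dotv_sqr_le.
Qed.

Lemma enormD x y : enorm (x + y) <= enorm x + enorm y.
Proof.
rewrite -(ler_pXn2r (isT : (0 < 2)%N)) ?nnegrE ?addr_ge0 ?enorm_ge0 //.
rewrite enorm_sqr dotvDl !(dotvC _ (x + y)) !dotvDl (dotvC y x) sqrrD !enorm_sqr.
have := le_trans (ler_norm _) (dotv_le x y); lra.
Qed.

Lemma enorm_sum I (r : seq I) (P : pred I) (F : I -> 'rV[R]_n) :
  enorm (\sum_(i <- r | P i) F i) <= \sum_(i <- r | P i) enorm (F i).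
Proof.
elim/big_rec2: _ => [|i u v _ le_uv]; first by rewrite (eqP (_ : enorm 0 == 0)) ?enorm_eq0.
by apply: le_trans (enormD _ _) _; rewrite lerD2l.
Qed.

Lemma enorm_le x M : (forall i, `|x 0 i| <= M) -> enorm x <= n%:R * M.
Proof. by move=> xM; have := norm2_le xM; rewrite card_ord. Qed.

Lemma omega_ge0 x y : 0 <= omega x y.
Proof. by rewrite /omega divr_ge0 ?mulr_ge0 ?norm2_ge0. Qed.

Lemma omega_sqr x y : x != 0 -> y != 0 ->
  omega x y ^+ 2 = 1 - dotv x y ^+ 2 / (enorm x * enorm y) ^+ 2.
Proof.
move=> x0 y0; rewrite /omega exprMn lagrange_identity exprVn mulrBl divff //.
by rewrite expf_neq0 // mulf_neq0 // enorm_eq0.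
Qed.

Lemma wedge2_le x y : norm2 (wedge (col_mx x y)) <= enorm x * enorm y.
Proof.
rewrite -(ler_pXn2r (isT : (0 < 2)%N)) ?nnegrE ?mulr_ge0 ?enorm_ge0 ?norm2_ge0 //.
by rewrite lagrange_identity lerBlDr lerDl sqr_ge0.
Qed.

Lemma omega_le1 x y : omega x y <= 1.
Proof.
rewrite /omega -/(enorm x) -/(enorm y).
have [->|nz] := eqVneq (enorm x * enorm y) 0; first by rewrite invr0 mulr0.
have gt0 : 0 < enorm x * enorm y by rewrite lt_def nz mulr_ge0 ?enorm_ge0.
by rewrite ler_pdivrMr // mul1r wedge2_le.
Qed.

(** Subtracting y from x does not change the exterior product of x and y. *)
Lemma omega_le_dist x y : y != 0 -> omega x y <= enorm (x - y) / enorm x.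
Proof.
move=> y0; have y_gt0 := enorm_gt0 y0.
have [->|x0] := eqVneq x 0.
  by rewrite /omega -/(enorm 0) (eqP (_ : enorm 0 == 0)) ?enorm_eq0 // mul0r invr0 !mulr0.
have x_gt0 := enorm_gt0 x0.
have eq_wedge : norm2 (wedge (col_mx x y)) = norm2 (wedge (col_mx (x - y) y)).
  apply/eqP; rewrite -(eqrXn2 (n := 2)) ?norm2_ge0 //; apply/eqP.
  rewrite !lagrange_identity !exprMn !enorm_sqr !dotvBl !(dotvC _ (x - y)) !dotvBl (dotvC y x).
  ring.
rewrite /omega eq_wedge -/(enorm x) -/(enorm y) ler_pdivrMr ?mulr_gt0 // mulrA.
by rewrite divfK ?gt_eqF // wedge2_le.
Qed.

(** The left-hand side is the distance from x to the line spanned by y. *)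
Lemma omega_dist_line x y : x != 0 -> y != 0 ->
  enorm (x - (dotv x y / dotv y y) *: y) = omega x y * enorm x.
Proof.
move=> x0 y0; apply/eqP; have := omega_ge0 x y; have := enorm_ge0 x => nx ox.
rewrite -(eqrXn2 (n := 2)) ?enorm_ge0 ?(mulr_ge0 ox nx) //.
have yy0 : dotv y y != 0 by rewrite -enorm_sqr expf_neq0 // enorm_eq0.
have xx0 : dotv x x != 0 by rewrite -enorm_sqr expf_neq0 // enorm_eq0.
rewrite exprMn omega_sqr // exprMn !enorm_sqr !dotvBl !dotvZl.
rewrite !(dotvC _ (x - _)) !dotvBl !dotvZl (dotvC y x); apply/eqP.
by field; rewrite xx0 yy0.
Qed.

Lemma omega_leE x y x' y' : x != 0 -> y != 0 -> x' != 0 -> y' != 0 ->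
  (omega x y <= omega x' y') =
  (dotv x' y' ^+ 2 * (enorm x * enorm y) ^+ 2 <= dotv x y ^+ 2 * (enorm x' * enorm y') ^+ 2).
Proof.
move=> x0 y0 x'0 y'0.
have p0 : 0 < (enorm x * enorm y) ^+ 2 by rewrite exprn_gt0 // mulr_gt0 ?enorm_gt0.
have p'0 : 0 < (enorm x' * enorm y') ^+ 2 by rewrite exprn_gt0 // mulr_gt0 ?enorm_gt0.
rewrite -(ler_pXn2r (isT : (0 < 2)%N)) ?nnegrE ?omega_ge0 // !omega_sqr //.
rewrite lerD2l lerN2 ler_pdivrMr // mulrAC ler_pdivlMr //.
Qed.

(** First-order condition at a minimum: moving x in an orthogonal direction z
    changes the square of the cosine at first order by a multiple of the
    scalar product of z and y. *)
Lemma omega_critical x y z : x != 0 -> y != 0 -> dotv x z = 0 ->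
  (forall t, omega x y <= omega (x + t *: z) y) -> dotv z y = 0.
Proof.
move=> x0 y0 xz min_x; apply/eqP/negPn/negP => q0.
set q := dotv z y in q0; pose p := dotv x y.
pose a := dotv x x; pose b := dotv z z.
have a0 : 0 < a by rewrite /a -enorm_sqr exprn_gt0 // enorm_gt0.
have b0 : 0 <= b by rewrite /b -enorm_sqr exprn_ge0 // enorm_ge0.
have yy0 : 0 < dotv y y by rewrite -enorm_sqr exprn_gt0 // enorm_gt0.
have key t : (p + t * q) ^+ 2 * a <= p ^+ 2 * (a + t ^+ 2 * b).
  have xt0 : x + t *: z != 0.
    apply/eqP => /(congr1 (fun u => dotv u x)) /=.
    rewrite dotvDl dotvZl (dotvC z x) xz mulr0 addr0 dotv0l => /eqP.
    by rewrite gt_eqF.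
  have := min_x t; rewrite omega_leE // !exprMn !enorm_sqr.
  rewrite !dotvDl !dotvZl !(dotvC _ (x + _)) !dotvDl !dotvZl (dotvC z x) xz.
  rewrite -/p -/q -/a -/b !mulrA ler_pM2r //.
  by rewrite !mulr0 addr0 add0r expr2 !mulrA.
have [p0|p0] := eqVneq p 0.
  have := key 1; rewrite p0 add0r mul1r expr0n mul0r.
  have : 0 < q ^+ 2 * a by rewrite mulr_gt0 // exprn_even_gt0.
  lra.
(* The inequality [key] reads 2 t c + t ^ 2 M <= 0. It fails for t = s c with s
   small in terms of M, unless c = 0. *)
pose M := q ^+ 2 * a - p ^+ 2 * b; pose c := p * q * a.
have c0 : 0 < c ^+ 2 by rewrite exprn_even_gt0 //= !mulf_neq0 // gt_eqF.
pose s := (1 + `|M|)^-1.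
have M1 : 0 < 1 + `|M| by rewrite ltr_wpDr.
have s0 : 0 < s by rewrite invr_gt0.
have sM : - (s * M) < 1.
  rewrite -mulrN /s mulrC ltr_pdivrMr // mul1r.
  have := ler_norm (- M); rewrite normrN; lra.
have h : (2 + s * M) * (s * c ^+ 2) <= 0.
  have := key (s * c); rewrite /c /M; nra.
have : 0 < (2 + s * M) * (s * c ^+ 2) by apply: mulr_gt0; [lra | exact: mulr_gt0].
lra.
Qed.
End Euclidean.

(** * Existence of closest directions *)

Section Minimizers.
Local Open Scope ring_scope.
Local Open Scope classical_set_scope.
Variables (R : realType) (n : nat).
Implicit Types x y z : 'rV[R]_n.

Lemma continuous_dotv (T : topologicalType) (f g : T -> 'rV[R]_n) :
  continuous f -> continuous g -> continuous (fun p => dotv (f p) (g p)).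
Proof.
move=> cf cg; rewrite /dotv.
pose F (i : 'I_n) := fun p => f p 0 i * g p 0 i.
have cF i : continuous (F i).
  move=> p; apply: continuousM.
    by apply: (@continuous_comp _ _ _ f (fun M : 'rV[R]_n => M 0 i)); [exact: cf | exact: coord_continuous].
  by apply: (@continuous_comp _ _ _ g (fun M : 'rV[R]_n => M 0 i)); [exact: cg | exact: coord_continuous].
suff H (s : seq 'I_n) : continuous (fun p => \sum_(i <- s) F i p) by exact: H.
elim: s => [|i s IH].
  rewrite (_ : (fun p => _) = cst 0); first by move=> p; apply: cvg_cst.
  by apply/funext => p; rewrite big_nil.
rewrite (_ : (fun p => _) = F i \+ (fun p => \sum_(i <- s) F i p)); last first.
  by apply/funext => p; rewrite big_cons.
by move=> p; apply: continuousD; [exact: cF | exact: IH].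
Qed.

Lemma unit_vectors_compact (S : set 'rV[R]_n) :
  closed S -> compact (S `&` [set x | dotv x x = 1]).
Proof.
move=> clS.
pose C := [set v : 'rV[R]_n | forall i, `[(-1 : R), 1]%classic (v ord0 i)].
have cC : compact C by apply: (@rV_compact _ n (fun=> `[(-1 : R), 1]%classic)) => i; exact: segment_compact.
apply: (subclosed_compact _ cC).
  apply: closedI => //.
  apply: (@preimage_closed _ _ (fun x => dotv x x) [set 1]); last exact: closed_eq.
  by move=> x _; apply: continuous_dotv => z; apply: cvg_id.
move=> x [_ /= xx1] i; have : `|x ord0 i| <= 1.
  apply: le_trans (coord_le_enorm _ _) _.
  rewrite -(ler_pXn2r (isT : (0 < 2)%N)) ?nnegrE ?enorm_ge0 //.
  by rewrite enorm_sqr xx1 expr1n.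
by rewrite ler_norml /= in_itv.
Qed.

Definition cone (S : set 'rV[R]_n) := forall a x, S x -> S (a *: x).

Lemma omegaZ a b x y : a != 0 -> b != 0 -> x != 0 -> y != 0 ->
  omega (a *: x) (b *: y) = omega x y.
Proof.
move=> a0 b0 x0 y0.
have ax0 : a *: x != 0 by rewrite scaler_eq0 negb_or a0.
have by0 : b *: y != 0 by rewrite scaler_eq0 negb_or b0.
apply/eqP; rewrite -(eqrXn2 (n := 2)) ?omega_ge0 // !omega_sqr //.
rewrite !enormZ dotvZl dotvC dotvZl dotvC !exprMn !real_normK ?num_real //.
have ex : enorm x != 0 by rewrite enorm_eq0.
have ey : enorm y != 0 by rewrite enorm_eq0.
by apply/eqP; field; rewrite ex ey a0 b0.
Qed.

(** [omega] is homogeneous of degree 0, so that it can be minimized on pairs of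
    unit vectors, which form a compact set. *)
Lemma omega_minimizers_nonempty (S T : set 'rV[R]_n) :
  closed S -> closed T -> cone S -> cone T -> S `\ 0 !=set0 -> T `\ 0 !=set0 ->
  omega_minimizers S T !=set0.
Proof.
move=> clS clT cS cT S0 T0.
have unitize (U : set 'rV[R]_n) x : cone U -> (U `\ 0) x ->
    (U `&` [set x | dotv x x = 1]) ((enorm x)^-1 *: x).
  move=> cU [Ux /eqP x0]; split; first exact: cU.
  rewrite /= dotvZl dotvC dotvZl -enorm_sqr; field.
  by rewrite enorm_eq0.
set K := (S `&` [set x | dotv x x = 1]) `*` (T `&` [set x | dotv x x = 1]).
have cK : compact K by apply: compact_setX; apply: unit_vectors_compact.
have K0 : K !=set0.
  have [x Sx] := S0; have [y Ty] := T0.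
  exists ((enorm x)^-1 *: x, (enorm y)^-1 *: y).
  by split; apply: unitize.
have cf : {within K, continuous (fun p : 'rV[R]_n * 'rV[R]_n => dotv p.1 p.2 * dotv p.1 p.2)}.
  apply: continuous_subspaceT => p.
  have cd : continuous (fun p : 'rV[R]_n * 'rV[R]_n => dotv p.1 p.2).
    by apply: continuous_dotv => q; [exact: cvg_fst | exact: cvg_snd].
  exact: (continuousM (cd p) (cd p)).
have [[x y] /set_mem [[Sx /= x1] [Ty /= y1]] max_xy] := compact_EVT_max K0 cK cf.
have nz (u : 'rV[R]_n) : dotv u u = 1 -> u != 0.
  by move=> u1; apply/eqP => u0; move: u1; rewrite u0 dotv0l => /eqP; rewrite eq_sym oner_eq0.
exists (x, y); split.
  by split; split => //=; apply/eqP; apply: nz.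
move=> [u v] [[/= Su u0] [Tv v0]].
have nu : u != 0 by apply/eqP.
have nv : v != 0 by apply/eqP.
have [S'u u1] := unitize _ _ cS (conj Su u0).
have [T'v v1] := unitize _ _ cT (conj Tv v0).
rewrite -[leRHS](@omegaZ (enorm u)^-1 (enorm v)^-1) ?invr_eq0 ?enorm_eq0 //.
rewrite omega_leE ?nz // !exprMn !enorm_sqr x1 y1 u1 v1 !mulr1 !expr2.
by apply: (max_xy (_, _)); apply/mem_set.
Qed.
End Minimizers.

(** * Row spaces and orthogonal complements *)

Section RowSpaces.
Local Open Scope ring_scope.
Variables (K : fieldType) (n : nat).

(** The row space of a matrix as an element of [{vspace _}]: angles and
    heights are about such subspaces, while the computations are about matrices. *)
Definition row_space e (Z : 'M[K]_(e, n)) : {vspace 'rV[K]_n} :=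
  <<[tuple row i Z | i < e]>>%VS.

Lemma mem_row_space e (Z : 'M[K]_(e, n)) x : (x \in row_space Z) = (x <= Z)%MS.
Proof.
apply/idP/idP => [/coord_span ->|/submxP [D ->]].
  apply: summx_sub => i _; apply: scalemx_sub.
  by rewrite -tnth_nth tnth_mktuple row_sub.
rewrite mulmx_sum_row; apply: memv_suml => i _; apply/memvZ/memv_span.
by apply/tnthP; exists i; rewrite tnth_mktuple.
Qed.

Lemma dim_row_space e (Z : 'M[K]_(e, n)) : row_free Z -> \dim (row_space Z) = e.
Proof.
move=> Zfree; apply/eqP; rewrite -[X in _ == X](size_tuple [tuple row i Z | i < e]).
rewrite -/(free _); apply/freeP => k k0 i.
have : (\row_j k j) *m Z = 0.
  rewrite mulmx_sum_row -[RHS]k0; apply: eq_bigr => j _.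
  by rewrite mxE -tnth_nth tnth_mktuple.
by move/eqP; rewrite mulmx_free_eq0 // => /eqP/rowP/(_ i); rewrite !mxE.
Qed.

Definition vbasis_mx (A : {vspace 'rV[K]_n}) : 'M[K]_(\dim A, n) :=
  \matrix_i (vbasis A)`_i.

Lemma row_space_vbasis_mx A : row_space (vbasis_mx A) = A.
Proof.
rewrite /row_space; have -> : [tuple row i (vbasis_mx A) | i < \dim A] = vbasis A.
  by apply: eq_from_tnth => i; rewrite tnth_mktuple rowK (tnth_nth 0).
exact/span_basis/vbasisP.
Qed.

Lemma vbasis_mx_free A : row_free (vbasis_mx A).
Proof.
apply: inj_row_free => v v0; apply/rowP => i; rewrite mxE.
have /freeP := basis_free (vbasisP A); apply.
by rewrite -[RHS]v0 mulmx_sum_row; apply: eq_bigr => j _; rewrite rowK.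
Qed.

Lemma mem_vbasis_mx (A : {vspace 'rV[K]_n}) (x : 'rV[K]_n) : (x \in A) = (x <= vbasis_mx A)%MS.
Proof. by rewrite -mem_row_space row_space_vbasis_mx. Qed.

Lemma row_space_eq e (Z : 'M[K]_(e, n)) (B : {vspace 'rV[K]_n}) : row_free Z ->
  \dim B = e -> (forall i, row i Z \in B) -> row_space Z = B.
Proof.
move=> Zfree dB ZB; apply/eqP; rewrite eqEdim dim_row_space // dB leqnn andbT.
by apply/span_subvP => x /tnthP [i ->]; rewrite tnth_mktuple.
Qed.

End RowSpaces.

Section Orthogonal.
Local Open Scope ring_scope.
Local Open Scope classical_set_scope.
Variables (R : realType) (n : nat).
Implicit Types (A B : {vspace 'rV[R]_n}) (s : seq 'rV[R]_n).

Lemma orth_inP A s x :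
  orth_in A s x <-> x \in A /\ forall y, y \in s -> dotv x y = 0.
Proof.
split=> -[xA xs]; split=> // y ys; first exact/xs/memv_span.
rewrite (@coord_span _ _ _ (in_tuple s) y ys) dotvC dotv_suml big1 // => i _.
by rewrite dotvZl dotvC xs ?mulr0 // mem_nth.
Qed.

Lemma orth_in_cone A s : cone (orth_in A s).
Proof.
move=> a x /orth_inP [xA xs]; apply/orth_inP; split; first exact: memvZ.
by move=> y ys; rewrite dotvZl xs // mulr0.
Qed.

Lemma mulmx_dotv m (x : 'rV[R]_n) (Q : 'M[R]_(m, n)) i :
  (x *m Q^T) 0 i = dotv x (row i Q).
Proof. by rewrite mxE; apply: eq_bigr => j _; rewrite !mxE. Qed.

(** The projection onto A writes membership in A as a system of linear
    equations, and each of them defines a closed set. *)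
Lemma orth_in_closed A s : closed (orth_in A s).
Proof.
(* x is in A if and only if x = projv A x. *)
pose M := lin1_mx (projv A).
have memA x : (x \in A) = (x *m (1%:M - M) == 0).
  rewrite mulmxBr mulmx1 mul_rV_lin1 subr_eq0.
  by apply/idP/eqP => /= [/projv_id -> //|->]; rewrite memv_proj.
have clo (y : 'rV[R]_n) : closed [set x | dotv x y = 0].
  apply: (@preimage_closed _ _ (fun x => dotv x y) [set 0]); last exact: closed_eq.
  move=> x _; apply: (@continuous_dotv _ _ _ id (cst y)) => z; [exact: cvg_id | exact: cst_continuous].
rewrite (_ : orth_in A s =
  (\bigcap_(i in setT) [set x | dotv x (row i (1%:M - M)^T) = 0]) `&`
  (\bigcap_(y in [set y | y \in s]) [set x | dotv x y = 0])).
  by apply: closedI; apply: closed_bigI => i _; apply: clo.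
apply/seteqP; split=> x.
  move=> /orth_inP [xA xs]; split=> [i _|y ys]; last exact: xs.
  rewrite /= -mulmx_dotv trmxK; move: xA; rewrite memA => /eqP ->.
  by rewrite mxE.
move=> [xA xs]; apply/orth_inP; split; last exact: xs.
rewrite memA; apply/eqP/rowP => i; have := xA i I.
by rewrite /= -mulmx_dotv trmxK => ->; rewrite mxE.
Qed.

(** Fewer equations than unknowns. *)
Lemma orth_in_nontrivial A s : (size s < \dim A)%N -> orth_in A s `\ 0 !=set0.
Proof.
move=> lt_s; pose Q := \matrix_(i < size s) s`_i.
pose N := kermx (vbasis_mx A *m Q^T).
have N0 : N != 0.
  rewrite -mxrank_eq0 mxrank_ker subn_eq0 -ltnNge.
  exact: leq_ltn_trans (rank_leq_col _) lt_s.
have u0 : nz_row N != 0 by rewrite nz_row_eq0.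
have : (nz_row N <= N)%MS by apply: nz_row_sub.
move/sub_kermxP; rewrite mulmxA => uQ.
exists (nz_row N *m vbasis_mx A); split; last first.
  by apply/eqP; rewrite mulmx_free_eq0 ?vbasis_mx_free.
apply/orth_inP; split; first by rewrite mem_vbasis_mx submxMl.
move=> y /(nthP 0) [i lti <-].
have := mulmx_dotv (nz_row N *m vbasis_mx A) Q (Ordinal lti).
by rewrite uQ mxE rowK.
Qed.

End Orthogonal.

(** * Principal pairs *)

Section PrincipalPairs.
Local Open Scope ring_scope.
Local Open Scope classical_set_scope.
Variables (R : realType) (n : nat) (A B : {vspace 'rV[R]_n}).

(** [principal_pairs A B i] is a prefix of [principal_pairs A B j] for i <= j, so
    the pair of index i can be read off without reference to the length. *)
Definition principal_pair i := last (0, 0) (principal_pairs A B i.+1).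

Local Notation X i := (principal_pair i).1.
Local Notation Y i := (principal_pair i).2.

Lemma principal_pairsE j : principal_pairs A B j = mkseq principal_pair j.
Proof.
elim: j => [//|j IH]; rewrite mkseqS -IH /principal_pair /=.
by rewrite last_rcons.
Qed.

Hypothesis dAB : (\dim A <= \dim B)%N.

Lemma principal_pair_min i : (i < \dim A)%N ->
  omega_minimizers (orth_in A (mkseq (fun l => X l) i)) (orth_in B (mkseq (fun l => Y l) i))
    (principal_pair i).
Proof.
move=> lti; rewrite {3}/principal_pair /= last_rcons principal_pairsE.
rewrite /unzip1 /unzip2 /mkseq -!map_comp -/(mkseq _ _) -/(mkseq _ _).
apply: xgetPex; apply: omega_minimizers_nonempty.
- exact: orth_in_closed.
- exact: orth_in_closed.
- exact: orth_in_cone.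
- exact: orth_in_cone.
- by apply: orth_in_nontrivial; rewrite size_mkseq.
- by apply: orth_in_nontrivial; rewrite size_mkseq; apply: leq_trans dAB.
Qed.

Lemma orth_mkseqP (V : {vspace 'rV[R]_n}) v i x :
  orth_in V (mkseq v i) x <-> x \in V /\ forall l, (l < i)%N -> dotv x (v l) = 0.
Proof.
split=> [/orth_inP|] [xV xs]; [split=> // l ltl|apply/orth_inP; split=> // y].
  by apply: xs; apply/mapP; exists l; rewrite // mem_iota.
by move=> /mapP [l]; rewrite mem_iota => /andP [_ ltl] ->; apply: xs.
Qed.

Lemma principal_pairP i : (i < \dim A)%N ->
  [/\ X i \in A, X i != 0, Y i \in B & Y i != 0].
Proof.
move=> /principal_pair_min [[[/orth_mkseqP [XA _] /eqP X0] [/orth_mkseqP [YB _] /eqP Y0]] _].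
by [].
Qed.

Lemma principal_pair_orth i l : (i < \dim A)%N -> (l < i)%N ->
  dotv (X i) (X l) = 0 /\ dotv (Y i) (Y l) = 0.
Proof.
move=> /principal_pair_min [[[/orth_mkseqP [_ Xo] _] [/orth_mkseqP [_ Yo] _]] _] ltl.
by split; [apply: Xo | apply: Yo].
Qed.

Lemma principal_pair_le i x y : (i < \dim A)%N ->
  x \in A -> x != 0 -> y \in B -> y != 0 ->
  (forall l, (l < i)%N -> dotv x (X l) = 0) ->
  (forall l, (l < i)%N -> dotv y (Y l) = 0) ->
  omega (X i) (Y i) <= omega x y.
Proof.
move=> /principal_pair_min [_ min_i] xA x0 yB y0 xo yo.
apply: (min_i (x, y)); split; split; try exact/eqP; exact/orth_mkseqP.
Qed.

(** X_i can be moved in the direction x without leaving the set on which it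
    minimizes. Hence the orthogonal complement of X_0, ..., X_i in A is also
    orthogonal to Y_0, ..., Y_i; this is what makes [omega_last_le] work. *)
Lemma principal_pair_critical i x : (i < \dim A)%N -> x \in A ->
  (forall l, (l <= i)%N -> dotv x (X l) = 0) -> dotv x (Y i) = 0.
Proof.
move=> lti xA xo; have [XA X0 YB Y0] := principal_pairP lti.
apply: (omega_critical X0 Y0); first by rewrite dotvC xo.
move=> t; apply: principal_pair_le => //.
- by rewrite memvD ?memvZ.
- apply/eqP => xt0; have := xo _ (leqnn i); move: X0; rewrite -enorm_eq0.
  have /(congr1 (fun u => dotv u (X i))) := xt0.
  rewrite dotvDl dotvZl xo // mulr0 addr0 dotv0l -enorm_sqr.
  by move/eqP; rewrite expf_eq0 /= => ->.
- move=> l ltl.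
  by rewrite dotvDl dotvZl (xo l (ltnW ltl)) mulr0 addr0; have [] := principal_pair_orth lti ltl.
- by move=> l ltl; have [_ ->] := principal_pair_orth lti ltl.
Qed.

Lemma omega_nthE j : omega_nth j.+1 A B = omega (X j) (Y j).
Proof. by []. Qed.

End PrincipalPairs.

(** * The largest angle as a distance *)

Section Psi.
Local Open Scope ring_scope.
Local Open Scope classical_set_scope.
Variables (R : realType) (n : nat).
Implicit Types (A B : {vspace 'rV[R]_n}).

(** The minima are taken over smaller and smaller sets. *)
Lemma principal_pair_mono A B i j : (\dim A <= \dim B)%N -> (j < \dim A)%N -> (i <= j)%N ->
  omega (principal_pair A B i).1 (principal_pair A B i).2 <=
  omega (principal_pair A B j).1 (principal_pair A B j).2.
Proof.
move=> dAB ltj leij; have [XA X0 YB Y0] := principal_pairP dAB ltj.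
apply: principal_pair_le => //; first exact: leq_ltn_trans ltj.
- by move=> l ltl; have [] := principal_pair_orth dAB ltj (leq_trans ltl leij).
- by move=> l ltl; have [] := principal_pair_orth dAB ltj (leq_trans ltl leij).
Qed.

(** The X_i form an orthogonal basis of A, and the distance from X_i to
    the line spanned by Y_i is omega_i times its norm, where omega_i <= omega_d. *)
Lemma omega_last_close A B d x : \dim A = d.+1 -> (\dim A <= \dim B)%N -> x \in A ->
  exists2 b, b \in B & enorm (x - b) <= d.+1%:R * omega_nth d.+1 A B * enorm x.
Proof.
move=> dA dAB xA.
pose X (i : 'I_d.+1) := (principal_pair A B i).1.
pose Y (i : 'I_d.+1) := (principal_pair A B i).2.
have PP (i : 'I_d.+1) : [/\ X i \in A, X i != 0, Y i \in B & Y i != 0].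
  by apply: (principal_pairP dAB); rewrite dA.
have Xorth (i j : 'I_d.+1) : i != j -> dotv (X i) (X j) = 0.
  rewrite -(inj_eq val_inj) neq_ltn => /orP [] lt; last first.
    by have [] := principal_pair_orth dAB (i := i) _ lt; rewrite ?dA.
  by rewrite dotvC; have [] := principal_pair_orth dAB (i := j) _ lt; rewrite ?dA.
pose M := \matrix_i X i.
have Mfree : row_free M.
  apply: inj_row_free => v v0; apply/rowP => i; rewrite mxE.
  have /(congr1 (fun u => dotv u (X i))) := v0.
  rewrite mulmx_sum_row dotv_suml (bigD1 i) //= big1 => [|j neq_ji].
    rewrite rowK dotvZl addr0 dotv0l => /eqP; rewrite mulf_eq0 -enorm_sqr expf_eq0 /=.
    by rewrite enorm_eq0; have [_ /negPf -> _ _] := PP i; rewrite orbF => /eqP.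
  by rewrite rowK dotvZl Xorth ?mulr0.
have : x \in row_space M.
  by rewrite (row_space_eq Mfree dA) // => i; rewrite rowK; have [] := PP i.
rewrite mem_row_space => /submxP [u xE].
have {}xE : x = \sum_i u 0 i *: X i.
  by rewrite xE mulmx_sum_row; apply: eq_bigr => i _; rewrite rowK.
have ubound i : `|u 0 i| * enorm (X i) <= enorm x.
  have [_ X0 _ _] := PP i; have := dotv_le x (X i).
  rewrite {1}xE dotv_suml (bigD1 i) //= big1 => [|j neq_ji]; last first.
    by rewrite dotvZl Xorth ?mulr0.
  rewrite addr0 dotvZl -enorm_sqr normrM (ger0_norm (sqr_ge0 _)) expr2 mulrA.
  by rewrite ler_pM2r ?enorm_gt0.
exists (\sum_i u 0 i *: ((dotv (X i) (Y i) / dotv (Y i) (Y i)) *: Y i)).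
  by apply: memv_suml => i _; have [_ _ YB _] := PP i; rewrite !memvZ.
rewrite {1}xE -sumrB; apply: le_trans (enorm_sum _ _ _) _.
rewrite -mulrA mulr_natl -[X in _ *+ X](card_ord d.+1) -sumr_const.
apply: ler_sum => i _; have [_ X0 _ Y0] := PP i.
rewrite -scalerBr enormZ omega_dist_line // mulrCA.
apply: ler_pM; rewrite ?omega_ge0 ?mulr_ge0 ?normr_ge0 ?enorm_ge0 //.
rewrite omega_nthE; apply: (principal_pair_mono dAB); first by rewrite dA.
by rewrite -ltnS.
Qed.

(** A nonzero vector x of A orthogonal to X_0, ..., X_(d-1) is orthogonal to
    Y_0, ..., Y_(d-1) too. Its neighbour b in B is therefore nearly orthogonal to
    the Y_i, and removing the components of b along them yields an admissible
    competitor for the last minimum at a cost of a factor d + 1. *)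
Lemma omega_last_le A B d eps : \dim A = d.+1 -> (\dim A <= \dim B)%N ->
  (forall x, x \in A -> exists2 b, b \in B & enorm (x - b) <= eps * enorm x) ->
  omega_nth d.+1 A B <= d.+1%:R * eps.
Proof.
move=> dA dAB close; have ltd : (d < \dim A)%N by rewrite dA.
pose X i := (principal_pair A B i).1; pose Y i := (principal_pair A B i).2.
have [x [/orth_mkseqP [xA xo] /eqP x0]] :
    orth_in A (mkseq X d) `\ 0 !=set0 by apply: orth_in_nontrivial; rewrite size_mkseq.
have [b bB xb] := close x xA.
have xY l : (l < d)%N -> dotv x (Y l) = 0.
  move=> ltl; apply: (principal_pair_critical dAB) => //; first exact: ltn_trans ltd.
  by move=> m lem; apply: xo; apply: leq_ltn_trans ltl.
pose y := b - \sum_(l < d) (dotv b (Y l) / dotv (Y l) (Y l)) *: Y l.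
have PP i : (i < d)%N -> [/\ X i \in A, X i != 0, Y i \in B & Y i != 0].
  by move=> lti; apply: (principal_pairP dAB); rewrite dA ltnW.
have yB : y \in B.
  rewrite memvB //; apply: memv_suml => l _; rewrite memvZ //.
  by have [] := PP l (ltn_ord l).
have ltA (i : 'I_d) : (i < \dim A)%N by apply: ltn_trans ltd.
have Yorth (i j : 'I_d) : i != j -> dotv (Y i) (Y j) = 0.
  rewrite -(inj_eq val_inj) neq_ltn => /orP [] lt; last first.
    by have [] := principal_pair_orth dAB (ltA i) lt.
  by rewrite dotvC; have [] := principal_pair_orth dAB (ltA j) lt.
have yo l : (l < d)%N -> dotv y (Y l) = 0.
  move=> ltl; have [_ _ _ Y0] := PP l ltl.
  rewrite dotvBl dotv_suml (bigD1 (Ordinal ltl)) //= big1 => [|j neq_j].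
    rewrite addr0 dotvZl divfK ?subrr //.
    by rewrite -enorm_sqr expf_neq0 // enorm_eq0.
  by rewrite dotvZl (Yorth j (Ordinal ltl)) ?mulr0.
have xy : enorm (x - y) <= d.+1%:R * eps * enorm x.
  rewrite /y opprB addrCA -mulrA mulr_natl mulrS addrC.
  apply: le_trans (enormD _ _) _; apply: lerD => //.
  apply: le_trans (enorm_sum _ _ _) _.
  rewrite -[X in _ *+ X](card_ord d) -sumr_const; apply: ler_sum => l _.
  have [_ _ _ Y0] := PP l (ltn_ord l); have y_gt0 := enorm_gt0 Y0.
  rewrite enormZ -enorm_sqr normrM normfV (ger0_norm (sqr_ge0 _)) expr2 invfM.
  rewrite mulrA mulfVK ?gt_eqF // ler_pdivrMr //.
  have -> : dotv b (Y l) = - dotv (x - b) (Y l) by rewrite dotvBl xY ?sub0r ?opprK.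
  rewrite normrN; apply: le_trans (dotv_le _ _) _.
  by rewrite ler_pM2r.
have x_gt0 := enorm_gt0 x0.
(* If y vanishes, the bound to be proved is at least 1. *)
have [y0|y0] := eqVneq y 0.
  rewrite omega_nthE; apply: (le_trans (omega_le1 _ _)).
  by move: xy; rewrite y0 subr0 -[leLHS]mul1r ler_pM2r.
rewrite omega_nthE; apply: (@le_trans _ _ (omega x y)).
  exact: (principal_pair_le dAB).
apply: le_trans (omega_le_dist _ y0) _.
by rewrite ler_pdivrMr.
Qed.
End Psi.

(** * Integer points and heights of rational subspaces *)

Section Integral.
Local Open Scope ring_scope.
Local Open Scope classical_set_scope.
Variables (R : realType) (n : nat).
Implicit Types (B : {vspace 'rV[R]_n}).

Local Notation real_mx := (map_mx (intr : int -> R)).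

(** The minors of Z extended by x are integers. Replacing x by x - y does not
    change them, and Laplace expansion along the row x - y shows that they are
    less than 1 in absolute value, so they vanish. *)
Lemma int_point_criterion e (Z : 'M[int]_(e, n)) (x : 'rV[int]_n) (y : 'rV[R]_n) :
  row_free (real_mx Z) -> (y <= real_mx Z)%MS ->
  e.+1%:R * enorm (real_mx x - y) * norm2 (wedge (real_mx Z)) < 1 ->
  (real_mx x <= real_mx Z)%MS.
Proof.
move=> Zfree yZ small; apply: submx_minors => // g.
have intg : minor (col_mx (real_mx x) (real_mx Z)) g = (minor (col_mx x Z) g)%:~R.
  by rewrite -map_col_mx minor_map.
suff lt1 : `|minor (col_mx (real_mx x) (real_mx Z)) g| < 1.
  move: lt1; rewrite intg -intr_norm -[1]/(1%:~R) ltr_int => lt1.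
  by rewrite (_ : minor _ _ = 0) //; lia.
have -> : minor (col_mx (real_mx x) (real_mx Z)) g =
    minor (col_mx (real_mx x - y) (real_mx Z)) g.
  rewrite -[LHS]subr0 -(minor_col_mx_eq0 g yZ) !minor_col_mx -sumrB.
  by apply: eq_bigr => j _; rewrite !mxE -mulrBl.
apply: le_lt_trans small; rewrite minor_col_mx; apply: le_trans (ler_norm_sum _ _ _) _.
rewrite -mulrA mulr_natl -[X in _ *+ X](card_ord e.+1) -sumr_const.
apply: ler_sum => j _; rewrite !normrM normrX normrN1 expr1n mul1r.
by apply: ler_pM; rewrite ?normr_ge0 ?coord_le_enorm ?minor_le_norm2.
Qed.

Lemma rational_int_vector (v : 'rV[rat]_n) :
  exists2 D : int, D != 0 & exists w : 'rV[int]_n,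
    map_mx intr w = D%:~R *: (map_mx ratr v : 'rV[R]_n).
Proof.
pose D := \prod_i denq (v 0 i).
exists D; first by apply/prodf_neq0 => i _; rewrite denq_neq0.
exists (\row_i (numq (v 0 i) * \prod_(j | j != i) denq (v 0 j))).
apply/rowP => i; rewrite !mxE /D [in RHS](bigD1 i) //= !intrM.
rewrite /ratr; field.
by rewrite intr_eq0 denq_neq0.
Qed.

(** Clearing denominators. The rows span B over the real numbers, but need not
    generate all the integer points of B. *)
Lemma rational_int_basis B e : rational_subspace B -> \dim B = e ->
  exists2 Z : 'M[int]_(e, n), row_free (real_mx Z) & row_space (real_mx Z) = B.
Proof.
move=> [X bX] dB.
have szX : size X == e.
  have /andP [/eqP spX /eqP frX] := bX.
  by rewrite -dB -spX frX size_map.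
have ex (i : 'I_e) : exists w : 'rV[int]_n, exists2 D : R, D != 0 &
    map_mx intr w = D *: (map_mx ratr X`_i).
  have [D D0 [w wE]] := rational_int_vector X`_i.
  by exists w; exists D%:~R; rewrite ?intr_eq0.
have [w wP] := choice ex.
pose Z := \matrix_(i < e) w i.
have rowZ i : row i (real_mx Z) = map_mx intr (w i) by rewrite -map_row rowK.
have ltX (i : 'I_e) : (i < size X)%N by rewrite (eqP szX).
have sz' : size (map (map_mx (ratr : rat -> R)) X) == e by rewrite size_map.
have Zfree : row_free (real_mx Z).
  apply: inj_row_free => v v0; apply/rowP => i; rewrite mxE.
  have /(@freeP _ _ _ (Tuple sz')) frX : free (Tuple sz') by have /andP [] := bX.
  have [Dw DwP] := choice (fun i => let: ex_intro2 D D0 wE := wP i in ex_intro _ D (conj D0 wE)).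
  have := frX (fun j => v 0 j * Dw j) _ i.
  have [nz _] := DwP i => H; apply: (mulIf nz); rewrite mul0r; apply: H.
  rewrite -[RHS]v0 mulmx_sum_row; apply: eq_bigr => j _; rewrite rowZ (DwP j).2 scalerA /=.
  by rewrite (nth_map 0) ?ltX.
exists Z => //; apply: row_space_eq => // i; rewrite rowZ; have [D _ ->] := wP i.
rewrite memvZ // (basis_mem bX) //; apply/mapP; exists X`_i => //.
by rewrite mem_nth.
Qed.

Lemma Zbasis_mul B e (X Y : 'M[int]_(e, n)) : is_Zbasis B X ->
  (forall i, map_mx intr (row i Y) \in B) -> exists U : 'M[int]_e, Y = U *m X.
Proof.
move=> [_ XB] YB.
have [u uP] := choice (fun i => let: ex_intro c (conj cE _) := XB _ (YB i) in ex_intro _ c cE).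
by exists (\matrix_i u i); apply/row_matrixP => i; rewrite row_mul rowK -uP.
Qed.

(** The rows of Z generate over the integers an integer basis of B, hence they
    span B. *)
Lemma Zbasis_row_space B e (Z : 'M[int]_(e, n)) : rational_subspace B -> \dim B = e ->
  is_Zbasis B Z -> row_free (real_mx Z) /\ row_space (real_mx Z) = B.
Proof.
move=> ratB dB ZB; have [Z0 Z0free Z0B] := rational_int_basis ratB dB.
have [U Z0E] : exists U : 'M[int]_e, Z0 = U *m Z.
  apply: (Zbasis_mul ZB) => i; rewrite -Z0B mem_row_space map_row; exact: row_sub.
have Zfree : row_free (real_mx Z).
  rewrite /row_free eqn_leq rank_leq_row -{1}(eqP Z0free) Z0E map_mxM.
  exact: mxrankM_maxr.
split=> //; apply: row_space_eq => // i; rewrite -map_row; exact: (ZB.1 i).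
Qed.

Lemma eq_norm2 (T : finType) (f g : T -> R) :
  (forall t, `|f t| = `|g t|) -> norm2 f = norm2 g.
Proof.
move=> fg; rewrite /norm2; congr Num.sqrt; apply: eq_bigr => t _.
by rewrite -(real_normK (num_real (f t))) fg real_normK ?num_real.
Qed.

(** Two Z-bases differ by an integer matrix with integer inverse, whose
    determinant is 1 or -1. *)
Lemma height_Zbasis B e (Y : 'M[int]_(e, n)) : rational_subspace B -> \dim B = e ->
  is_Zbasis B Y -> height B = norm2 (wedge (real_mx Y)).
Proof.
move=> ratB dB; subst e => YB; rewrite /height.
set X := xget _ _.
have XB : is_Zbasis B X by apply: (@xgetPex _ 0 [set X | is_Zbasis B X]); exists Y.
have [U YE] := Zbasis_mul XB YB.1; have [V XE] := Zbasis_mul YB XB.1.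
have [Yfree _] := Zbasis_row_space ratB (erefl _) YB.
(* U V is the identity because the rows of Y are independent. *)
have UV : real_mx (U *m V) = 1%:M.
  apply: (row_free_inj Yfree); rewrite mul1mx -map_mxM -mulmxA.
  by rewrite -XE -YE.
have detUV : \det U * \det V = 1.
  have := congr1 determinant UV; rewrite det_map_mx det1 det_mulmx.
  by move=> H; apply: (@intr_inj R).
have absU : `|\det U| = 1.
  have : (`|\det U| * `|\det V| = 1)%N by rewrite -abszM detUV.
  by move=> /eqP; rewrite muln_eq1 => /andP [/eqP H _]; lia.
apply: eq_norm2 => I; rewrite /wedge !ffunE -!/(minor _ _) YE map_mxM minor_mulmx.
by rewrite det_map_mx normrM -intr_norm absU mul1r.
Qed.

(** The first alternative is the default value taken by [height] in the absence
    of a Z-basis: the norm of the wedge of the zero matrix. *)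
Lemma height_cases B e : (0 < e)%N -> rational_subspaces e B ->
  height B = 0 \/ exists Z : 'M[int]_(e, n),
    [/\ row_free (real_mx Z), row_space (real_mx Z) = B & height B = norm2 (wedge (real_mx Z))].
Proof.
move=> e0 [ratB dB].
have [[Z ZB]|noZ] := pselect (exists Z : 'M[int]_(e, n), is_Zbasis B Z).
  right; exists Z; have [Zfree ZE] := Zbasis_row_space ratB dB ZB; split=> //.
  exact: height_Zbasis.
left; subst e; rewrite /height; case: xgetP => [X _ XB|_].
  by case: noZ; exists X.
rewrite /norm2 big1 ?sqrtr0 // => I _; rewrite /wedge ffunE map_mx0.
rewrite (_ : colsub _ _ = 0); last by apply/matrixP => i j; rewrite !mxE.
by rewrite -[X in \det X](scale0r 0) detZ expr0n gtn_eqF // mul0r expr0n.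
Qed.

Lemma minors_row_space (K : fieldType) e (Z Z' : 'M[K]_(e, n)) :
  row_free Z -> row_free Z' -> (forall f, minor Z f = minor Z' f) -> row_space Z = row_space Z'.
Proof.
move=> Zfree Z'free eqm; apply/vspaceP => x; rewrite !mem_row_space.
have sub (W W' : 'M[K]_(e, n)) : row_free W' -> (forall f, minor W f = minor W' f) ->
    (x <= W)%MS -> (x <= W')%MS.
  move=> W'free eqW xW; apply: submx_minors => // g.
  rewrite -(minor_col_mx_eq0 g xW) !minor_col_mx.
  by apply: eq_bigr => j _; rewrite eqW.
by apply/idP/idP; apply: sub.
Qed.

(** Northcott's property: by [minors_row_space] a subspace is determined by its
    maximal minors, which are integers bounded in terms of M. *)
Lemma finite_bounded_height e (M : R) :
  finite_set [set B | exists Z : 'M[int]_(e, n),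
    [/\ row_free (real_mx Z), row_space (real_mx Z) = B & norm2 (wedge (real_mx Z)) <= M]].
Proof.
pose K := (Num.trunc M).+1.
pose T := {ffun {ffun 'I_e -> 'I_n} -> 'I_(K + K).+1}.
pose spec (m : T) B := exists2 Z : 'M[int]_(e, n),
  row_free (real_mx Z) /\ row_space (real_mx Z) = B &
  forall f : {ffun 'I_e -> 'I_n}, minor Z f = (m f : nat)%:Z - K%:Z.
apply: (@sub_finite_set _ _ ((fun m : T => xget 0%VS [set B | spec m B]) @` setT)); last first.
  by apply: finite_image; exact: finite_finset.
move=> B [Z [Zfree ZB Zle]].
have Zbound f : (`|minor Z f| <= K)%N.
  have : `|minor (real_mx Z) f| < K%:R.
    apply: le_lt_trans (minor_le_norm2 _ _) _; apply: le_lt_trans Zle _.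
    by rewrite /K; exact: truncnS_gt.
  by rewrite minor_map -intr_norm -[K%:R]/(K%:~R) ltr_int; lia.
(* Minors are shifted by K to be encoded as elements of a finite type. *)
pose m : T := [ffun f : {ffun 'I_e -> 'I_n} => inord (absz (minor Z f + K%:Z)%R)].
have mE f : (m f : nat)%:Z - K%:Z = minor Z f.
  have aux1 (z : int) (k : nat) : (`|z| <= k)%N -> (absz (z + k%:Z)%R < (k + k).+1)%N by lia.
  have aux2 (z : int) (k : nat) : (`|z| <= k)%N -> (absz (z + k%:Z)%R)%:Z - k%:Z = z by lia.
  by rewrite ffunE inordK ?aux2 //; apply: aux1.
exists m => //; apply: xget_unique.
  by exists Z => // f; rewrite mE.
move=> B' [Z' [Z'free <-] eqm]; rewrite -ZB; apply: minors_row_space => // f.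
rewrite !minor_map; congr (_%:~R).
have finE (W : 'M[int]_(e, n)) : minor W f = minor W [ffun i => f i].
  by rewrite /minor; congr (\det _); apply/matrixP => i j; rewrite !mxE ffunE.
by rewrite finE eqm mE -finE.
Qed.

End Integral.

(** * Logarithms in base 2 and bounds *)

Section Estimates.
Local Open Scope ring_scope.
Variable R : realType.
Implicit Types x y : R.

Definition log2 x : R := ln x / ln 2.

Lemma ln2_gt0 : 0 < ln 2 :> R.
Proof. by rewrite ln_gt0 // ltr1n. Qed.

Lemma log2M x y : 0 < x -> 0 < y -> log2 (x * y) = log2 x + log2 y.
Proof. by move=> x0 y0; rewrite /log2 lnM ?posrE // mulrDl. Qed.

Lemma log2V x : 0 < x -> log2 x^-1 = - log2 x.
Proof. by move=> x0; rewrite /log2 lnV ?posrE // mulNr. Qed.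

Lemma log2_2X k : log2 (2 ^+ k) = k%:R.
Proof. by rewrite /log2 lnXn ?ltr0n // -(mulr_natl (ln 2)) mulfK // gt_eqF // ln2_gt0. Qed.

Lemma log2_powR x p : log2 (x `^ p) = p * log2 x.
Proof. by rewrite /log2 ln_powR mulrA. Qed.

Lemma ltr_log2 x y : 0 < x -> 0 < y -> (log2 x < log2 y) = (x < y).
Proof. by move=> x0 y0; rewrite /log2 ltr_pM2r ?invr_gt0 ?ln2_gt0 // ltr_ln ?posrE. Qed.

Lemma ler_log2 x y : 0 < x -> 0 < y -> (log2 x <= log2 y) = (x <= y).
Proof. by move=> x0 y0; rewrite /log2 ler_pM2r ?invr_gt0 ?ln2_gt0 // ler_ln ?posrE. Qed.

Lemma log2_1 : log2 1 = 0.
Proof. by rewrite /log2 ln1 mul0r. Qed.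

Lemma large_nat (y : R) : exists k : nat, y < k%:R.
Proof. by exists (Num.trunc y).+1; apply: truncnS_gt. Qed.

Lemma finite_bounded (T : choiceType) (S : set T) (f : T -> R) :
  finite_set S -> exists M : R, forall t, S t -> f t <= M.
Proof.
move=> /finite_seqP [l ->]; exists (\sum_(t <- l) `|f t|) => t /= tl.
apply: le_trans (ler_norm _) _; rewrite (big_rem t) //= lerDl.
exact: sumr_ge0.
Qed.

End Estimates.

(** * A subspace with lacunary coordinates and its approximations *)

Section Construction.
Local Open Scope ring_scope.
Local Open Scope classical_set_scope.
(* The ambient dimension is n = N + r + 1, the subspace has dimension r + 1, and
   a k is the position of the k-th digit 1 in the binary expansions of the
   coordinates of xi. *)
Variables (R : realType) (N r : nat) (a : nat -> nat).
Hypothesis N_gt0 : (0 < N)%N.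
Hypothesis a_gt0 : (0 < a 0)%N.
Hypothesis a_growth : forall k, (3 * a k <= a k.+1)%N.

Local Notation n := (N + r).+1.
Local Notation real_mx := (map_mx (intr : int -> R)).

Lemma a_pos k : (0 < a k)%N.
Proof. elim: k => // k; have := a_growth k; lia. Qed.

Lemma a_lt k : (a k < a k.+1)%N.
Proof. have := a_growth k; have := a_pos k; lia. Qed.

(** The coordinate of xi that receives the digit 2^(-a_k). Coordinate 0 is kept
    for the constant 1. *)
Definition digit_col k := (k %% N).+1.

(** 2^(a_k) times the k-th partial sum of the coordinate c of xi. Coordinate 0
    is 2^(a_k) itself. *)
Fixpoint trunc_entry k c : nat :=
  if k is l.+1 then (2 ^ (a k - a l) * trunc_entry l c + (c == digit_col k))%N
  else ((c == 0%N) * 2 ^ a 0)%N.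

Lemma trunc_entry0 k : trunc_entry k 0 = (2 ^ a k)%N.
Proof.
elim: k => [|k IH] /=; first by rewrite mul1n.
by rewrite IH addn0 -expnD subnK // ltnW // a_lt.
Qed.

Lemma trunc_entry_le k c : (trunc_entry k c + (c != 0) <= 2 ^ a k)%N.
Proof.
case: c => [|c]; first by rewrite trunc_entry0 addn0.
elim: k => [|k IH]; first by rewrite /= mul0n add0n expn_gt0.
have eqa : a k.+1 = (a k.+1 - a k + a k)%N by rewrite subnK // ltnW // a_lt.
have ge2 : (2 <= 2 ^ (a k.+1 - a k))%N.
  by rewrite -{1}(expn1 2) leq_exp2l // subn_gt0 a_lt.
rewrite [in leqRHS]eqa expnD.
apply: (@leq_trans (2 ^ (a k.+1 - a k) * trunc_entry k c.+1 + 2)%N).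
  by rewrite /=; case: (_ == _); lia.
move: IH ge2; move: (2 ^ _)%N (2 ^ _)%N => u v /=; nia.
Qed.

(** The last digit added is 2^(-a_k), so the numerator over 2^(a_k) is odd. The
    truncation is thereby primitive, even modulo the other basis vectors of the
    approximating subspaces, whose height is then at least 2^(a_k). *)
Lemma trunc_entry_odd k : odd (trunc_entry k.+1 (digit_col k.+1)).
Proof.
rewrite /= eqxx oddD oddM oddX /=.
by have := a_lt k; rewrite -subn_gt0 lt0n => /negPf ->.
Qed.

Definition truncation k : 'rV[int]_n := \row_(c < n) (trunc_entry k c)%:Z.
Definition unit_vec (c : nat) : 'rV[int]_n := \row_(j < n) (j == c :> nat)%:Z.

Lemma truncationS k : truncation k.+1 = (2 ^ (a k.+1 - a k))%:Z *: truncation k + unit_vec (digit_col k.+1).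
Proof. by apply/rowP => c; rewrite !mxE /=; lia. Qed.

Local Notation D k := (2 ^+ a k : R).

Lemma D_gt0 k : 0 < D k.
Proof. by rewrite exprn_gt0. Qed.

Lemma D_growth k : 2 * D k <= D k.+1.
Proof. by rewrite -exprS ler_eXn2l ?a_lt // ltr1n. Qed.

Definition partial_sum k (c : nat) : R := (trunc_entry k c)%:R / D k.

Lemma partial_sumS k c : partial_sum k.+1 c = partial_sum k c + (c == digit_col k.+1)%:R / D k.+1.
Proof.
rewrite /partial_sum /= natrD natrM mulrDl; congr (_ + _).
rewrite -{2}(subnK (ltnW (a_lt k))) exprD natrX.
by field; rewrite !expf_neq0 ?pnatr_eq0.
Qed.

Lemma partial_sum_mono c k l : (k <= l)%N -> partial_sum k c <= partial_sum l c.
Proof.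
move=> /subnK <-; elim: (l - k)%N => // m IH; apply: (le_trans IH).
by rewrite addSn partial_sumS lerDl divr_ge0 ?ler0n // ltW ?D_gt0.
Qed.

(** The right endpoint of an interval that contains all the later partial sums:
    the remaining digits are dominated by a geometric series of ratio 1/2. *)
Lemma partial_sum_upper_mono c k l : (k <= l)%N -> partial_sum l c + 2 / D l.+1 <= partial_sum k c + 2 / D k.+1.
Proof.
move=> /subnK <-; elim: (l - k)%N => // m; apply: le_trans.
rewrite addSn; set i := (m + k)%N; rewrite partial_sumS -addrA lerD2l.
have : 2 / D i.+2 <= 1 / D i.+1.
  rewrite ler_pdivrMr ?D_gt0 // mulrAC ler_pdivlMr ?D_gt0 // mul1r.
  exact: D_growth.
have : (c == digit_col i.+1)%:R / D i.+1 <= 1 / D i.+1.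
  by rewrite ler_pM2r ?invr_gt0 ?D_gt0 // lern1 leq_b1.
rewrite -[2 / D i.+1]/((1 + 1) / D i.+1) mulrDl; lra.
Qed.

Lemma partial_sum_le_upper c k l : partial_sum k c <= partial_sum l c + 2 / D l.+1.
Proof.
have Dk m : 0 <= 2 / D m :> R by rewrite divr_ge0 // ltW // D_gt0.
case: (leqP k l) => [/partial_sum_mono h|/ltnW /partial_sum_upper_mono h].
  by apply: le_trans (h c) _; rewrite lerDl.
by apply: le_trans (h c); rewrite lerDl.
Qed.

Definition xi (c : nat) : R := sup (range (partial_sum^~ c)).

Lemma xi_ge c k : partial_sum k c <= xi c.
Proof.
apply: ub_le_sup; last by exists k.
by exists (partial_sum 0 c + 2 / D 1) => _ [l _ <-]; apply: partial_sum_le_upper.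
Qed.

Lemma xi_le c k : xi c <= partial_sum k c + 2 / D k.+1.
Proof.
apply: ge_sup; first by exists (partial_sum 0 c), 0%N.
by move=> _ [l _ <-]; apply: partial_sum_le_upper.
Qed.

Lemma xi_ge_digit k l : (k < l)%N -> 1 / D l <= xi (digit_col l) - partial_sum k (digit_col l).
Proof.
case: l => // l; rewrite ltnS => lekl; rewrite lerBrDl.
apply: le_trans (xi_ge _ l.+1); rewrite partial_sumS eqxx lerD2r; exact: partial_sum_mono.
Qed.

Lemma partial_sum0 k : partial_sum k 0 = 1.
Proof. by rewrite /partial_sum trunc_entry0 natrX divff // gt_eqF ?D_gt0. Qed.

Lemma xi0 : xi 0 = 1.
Proof.
rewrite /xi; suff -> : range (partial_sum^~ 0%N) = [set 1] by rewrite sup1.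
by apply/seteqP; split=> [_ [k _ <-]|_ ->]; [rewrite /= partial_sum0 | exists 0%N; rewrite ?partial_sum0].
Qed.

Lemma xi_bound c : `|xi c| <= 1.
Proof.
have x_ge0 k : 0 <= partial_sum k c by rewrite /partial_sum divr_ge0 ?ler0n // ltW ?D_gt0.
rewrite ger0_norm ?(le_trans (x_ge0 0%N) (xi_ge _ _)) //.
apply: ge_sup; first by exists (partial_sum 0 c), 0%N.
move=> _ [k _ <-]; rewrite /partial_sum ler_pdivrMr ?D_gt0 // mul1r -natrX ler_nat.
by apply: leq_trans (trunc_entry_le k c); rewrite leq_addr.
Qed.

Definition xi_vec : 'rV[R]_n := \row_(c < n) xi c.

Definition target_mx : 'M[R]_(r.+1, n) :=
  \matrix_(i < r.+1, c < n) if i == 0 then xi c else ((c == N + i :> nat)%N)%:R.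

Definition target : {vspace 'rV[R]_n} := row_space target_mx.

Lemma target_mx_free : row_free target_mx.
Proof.
apply: inj_row_free => v v0.
have E (c : 'I_n) : v 0 0 * xi c + \sum_(i < r) v 0 (lift ord0 i) * ((c == N + i.+1 :> nat)%N)%:R = 0.
  have /rowP/(_ c) := v0; rewrite !mxE big_ord_recl mxE /= => E.
  by rewrite -[RHS]E; congr (_ + _); apply: eq_bigr => i _; rewrite mxE.
have v00 : v 0 0 = 0.
  have := E ord0; rewrite xi0 mulr1 big1 ?addr0 // => i _.
  by rewrite addnS mulr0.
apply/rowP => i; rewrite mxE; case: (fintype.unliftP ord0 i) => [j ->|-> //].
have lt : (N + j.+1 < n)%N by rewrite ltnS leq_add2l.
have := E (Ordinal lt); rewrite v00 mul0r add0r (bigD1 j) //= eqxx mulr1.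
rewrite big1 ?addr0 // => l neq; rewrite eqn_add2l eqSS.
by rewrite [_ == _](negPf _) ?mulr0 // eq_sym.
Qed.

Lemma dim_target : \dim target = r.+1.
Proof. exact: dim_row_space target_mx_free. Qed.

Lemma xi_in_target : xi_vec \in target.
Proof.
rewrite mem_row_space (_ : xi_vec = row 0 target_mx) ?row_sub //.
by apply/rowP => c; rewrite !mxE.
Qed.

Lemma unit_vec_in_target i : (0 < i <= r)%N -> real_mx (unit_vec (N + i)) \in target.
Proof.
move=> /andP [i0 ler]; rewrite mem_row_space.
rewrite (_ : real_mx _ = row (inord i) target_mx) ?row_sub //.
apply/rowP => c; rewrite !mxE -(inj_eq val_inj) /= inordK // (gtn_eqF i0).
by case: (_ == _).
Qed.

Lemma target_decomposition v : v \in target -> exists w : 'rV[R]_r,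
  v = v 0 0 *: xi_vec + \sum_(i < r) w 0 i *: real_mx (unit_vec (N + i.+1)).
Proof.
rewrite mem_row_space => /submxP [u vE]; exists (\row_i u 0 (lift ord0 i)).
have E (c : 'I_n) : v 0 c = u 0 0 * xi c + \sum_(i < r) u 0 (lift ord0 i) * ((c == N + i.+1 :> nat)%N)%:R.
  rewrite vE mxE big_ord_recl mxE /=; congr (_ + _).
  by apply: eq_bigr => i _; rewrite mxE.
have v00 : v 0 0 = u 0 0.
  rewrite (E 0) xi0 mulr1 big1 ?addr0 // => i _.
  by rewrite addnS mulr0.
apply/rowP => c; rewrite E !mxE v00 summxE; congr (_ + _).
by apply: eq_bigr => i _; rewrite !mxE; case: (_ == _).
Qed.

(** The columns 0, the columns of the digits k + 1, ..., k + s, and the last r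
    columns: on these columns [approx_mx k s] is triangular. *)
Definition pivot k s i : nat :=
  if i == 0%N then 0%N else if (i <= s)%N then digit_col (k + i) else (N + (i - s))%N.

(** The rows span the same space as the truncations of index k, ..., k + s and
    the last r vectors of the canonical basis, because consecutive truncations
    differ by a digit vector ([truncationS]). In this form the matrix is
    visibly a Z-basis. *)
Definition approx_mx k s : 'M[int]_((s + r).+1, n) :=
  \matrix_(i < (s + r).+1, c < n) if i == 0 then (trunc_entry k c)%:Z else (c == pivot k s i :> nat)%:Z.

Lemma digit_col_neq k i j : (i < j)%N -> (j - i < N)%N -> digit_col (k + i) != digit_col (k + j).
Proof.
move=> ltij ltN; rewrite /digit_col eqSS -(subnKC (ltnW ltij)) addnA.
rewrite -{1}[(k + i)%N]addn0 eqn_modDl mod0n modn_small //.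
by rewrite eq_sym -lt0n subn_gt0.
Qed.

Lemma digit_col_le k : (digit_col k <= N)%N.
Proof. exact: ltn_pmod. Qed.

Lemma pivot_lt k s i : (i < (s + r).+1)%N -> (pivot k s i < n)%N.
Proof.
rewrite /pivot; case: eqP => // _; case: ifP => _ lt; last by lia.
by have := digit_col_le (k + i); lia.
Qed.

Lemma pivot_gt0 k s i : (0 < pivot k s i.+1)%N.
Proof. by rewrite /pivot /=; case: ifP => // _; rewrite addn_gt0 N_gt0. Qed.

Lemma pivot_inj k s i j : (s <= N)%N -> pivot k s i = pivot k s j -> i = j.
Proof.
move=> lesN; wlog lt : i j / (i < j)%N => [H|].
  by case: (ltngtP i j) => // lt eqc; [apply: H | apply/esym/H].
have j0 : (j == 0)%N = false by apply/gtn_eqF/(leq_ltn_trans _ lt).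
rewrite /pivot j0; case: (posnP i) => [->|i0].
  case: ifP => _ // H; lia.
case: (leqP j s) => [lejs|ltsj]; case: (leqP i s) => leis; try lia.
  move=> /eqP; rewrite (negPf (digit_col_neq k lt _)) //; lia.
by have := digit_col_le (k + i); lia.
Qed.

Lemma pivot_neq_digit_col k s i : (s < N)%N -> pivot k s i != digit_col k.
Proof.
move=> ltsN; rewrite /pivot; case: (posnP i) => [//|i0]; case: ifP => leis.
  by rewrite eq_sym -{1}[k]addn0 digit_col_neq //; lia.
by rewrite gtn_eqF //; have := digit_col_le k; lia.
Qed.

Lemma pivot_neq_next_digit_col k s i : (s < N)%N -> pivot k s i != digit_col (k + s.+1).
Proof.
move=> ltsN; rewrite /pivot; case: (posnP i) => [//|i0]; case: ifP => leis.
  by rewrite digit_col_neq //; lia.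
by rewrite gtn_eqF //; have := digit_col_le (k + s.+1); lia.
Qed.

Definition pivot_ord k s (i : 'I_(s + r).+1) : 'I_n := inord (pivot k s i).

Lemma pivot_ordE k s (i : 'I_(s + r).+1) : pivot_ord k i = pivot k s i :> nat.
Proof. by rewrite /pivot_ord inordK // pivot_lt. Qed.

Lemma mul_approx_mx k s (u : 'rV[R]_(s + r).+1) (c : 'I_n) :
  (u *m real_mx (approx_mx k s)) 0 c =
  u 0 0 * (trunc_entry k c)%:R + \sum_(i < s + r) u 0 (lift ord0 i) * ((c == pivot k s i.+1 :> nat)%N)%:R.
Proof.
rewrite mxE big_ord_recl !mxE /=; congr (_ + _).
by apply: eq_bigr => i _; rewrite !mxE /=.
Qed.

Lemma mul_approx_mx0 k s (u : 'rV[R]_(s + r).+1) :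
  (u *m real_mx (approx_mx k s)) 0 0 = u 0 0 * D k.
Proof.
rewrite mul_approx_mx trunc_entry0 natrX big1 ?addr0 // => i _.
by rewrite ltn_eqF ?mulr0 // pivot_gt0.
Qed.

Lemma mul_approx_mx_pivot k s (u : 'rV[R]_(s + r).+1) (i : 'I_(s + r)) : (s <= N)%N ->
  (u *m real_mx (approx_mx k s)) 0 (pivot_ord k (lift ord0 i)) =
  u 0 0 * (trunc_entry k (pivot k s i.+1))%:R + u 0 (lift ord0 i).
Proof.
move=> lesN; rewrite mul_approx_mx !pivot_ordE /=; congr (_ + _).
rewrite (bigD1 i) //= eqxx mulr1 big1 ?addr0 // => j neq_ji.
case: eqP => [/(pivot_inj lesN)|_]; last by rewrite mulr0.
by move=> /succn_inj/val_inj eqij; rewrite eqij eqxx in neq_ji.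
Qed.

Lemma mul_approx_mx_out k s (u : 'rV[R]_(s + r).+1) (c : 'I_n) :
  (forall i, pivot k s i != c) ->
  (u *m real_mx (approx_mx k s)) 0 c = u 0 0 * (trunc_entry k c)%:R.
Proof.
move=> out; rewrite mul_approx_mx big1 ?addr0 // => i _.
by rewrite eq_sym (negPf (out _)) mulr0.
Qed.

Lemma approx_mx_free k s : (s <= N)%N -> row_free (real_mx (approx_mx k s)).
Proof.
move=> lesN; apply: inj_row_free => u u0.
have u00 : u 0 0 = 0.
  have := mul_approx_mx0 k u; rewrite u0 mxE => /esym/eqP.
  by rewrite mulf_eq0 orbC gt_eqF ?D_gt0 //= => /eqP.
apply/rowP => i; rewrite mxE; case: (fintype.unliftP ord0 i) => [j ->|-> //].
by have := mul_approx_mx_pivot k u j lesN; rewrite u0 mxE u00 mul0r add0r => <-.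
Qed.

Definition approx_space k s : {vspace 'rV[R]_n} := row_space (real_mx (approx_mx k s)).

Lemma dim_approx_space k s : (s <= N)%N -> \dim (approx_space k s) = (s + r).+1.
Proof. by move=> lesN; apply/dim_row_space/approx_mx_free. Qed.

Lemma approx_space_rational k s : (s <= N)%N -> rational_subspaces (s + r).+1 (approx_space k s).
Proof.
move=> lesN; split; last exact: dim_approx_space.
exists [tuple row i (map_mx (intr : int -> rat) (approx_mx k s)) | i < (s + r).+1].
have -> : map (map_mx (ratr : rat -> R)) [tuple row i (map_mx (intr : int -> rat) (approx_mx k s)) | i < (s + r).+1]
   = [tuple row i (real_mx (approx_mx k s)) | i < (s + r).+1].
  rewrite /= -map_comp; apply: eq_map => i /=; rewrite map_row; congr (row _ _).
  by apply/matrixP => p q; rewrite !mxE ratr_int.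
rewrite /basis_of -/(row_space _) eqxx /= /free -/(row_space _) dim_row_space ?approx_mx_free //.
by rewrite size_map size_enum_ord.
Qed.

(** The coefficient of the truncation is a rational number which becomes an
    integer after multiplication by 2^(a_k) (coordinate 0) and by an odd number
    (the column of the last digit, which is no pivot), hence an integer. The
    other coefficients follow by reading the pivot columns. *)
Lemma approx_mx_Zbasis k s : (s < N)%N -> is_Zbasis (approx_space k.+1 s) (approx_mx k.+1 s).
Proof.
move=> ltsN; split=> [i|y].
  by rewrite mem_row_space map_row row_sub.
rewrite mem_row_space => /submxP [u yE].
have u0 : exists z : int, u 0 0 = z%:~R.
  have posn : (digit_col k.+1 < n)%N by have := digit_col_le k.+1; lia.
  have := mul_approx_mx0 k.+1 u; rewrite -yE mxE => e0.
  have := @mul_approx_mx_out k.+1 s u (Ordinal posn) (fun i => pivot_neq_digit_col _ _ ltsN).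
  rewrite -yE mxE; set w := trunc_entry k.+1 _ => e1.
  have cop : coprime (2 ^ a k.+1) w by rewrite coprimeXl // coprime2n trunc_entry_odd.
  have : coprimez (2 ^ a k.+1)%N%:Z w%:Z by [].
  case/coprimezP => -[p q] /= pq.
  (* Bezout: p 2^(a_k) + q w = 1, where w is odd. *)
  exists (p * y 0 0 + q * y 0 (Ordinal posn)).
  have pqR : p%:~R * D k.+1 + q%:~R * w%:R = 1 :> R.
    by rewrite -[RHS]/(1%:~R) -pq intrD !intrM -natrX !pmulrn.
  transitivity (u 0 0 * (p%:~R * D k.+1 + q%:~R * w%:R)); first by rewrite pqR mulr1.
  by rewrite intrD !intrM e0 e1; ring.
have uz i : exists z : int, u 0 i = z%:~R.
  case: (fintype.unliftP ord0 i) => [j ->|-> //]; have [z zE] := u0.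
  exists (y 0 (pivot_ord k.+1 (lift ord0 j)) - z * trunc_entry k.+1 (pivot k.+1 s j.+1)).
  have := mul_approx_mx_pivot k.+1 u j (ltnW ltsN); rewrite -yE mxE intrB intrM => ->.
  by rewrite zE -!pmulrn; ring.
have [c cE] := choice uz.
have uc : u = real_mx (\row_i c i) by apply/rowP => i; rewrite !mxE cE.
have inj m p (M M' : 'M[int]_(m, p)) : real_mx M = real_mx M' -> M = M'.
  by move=> /matrixP H; apply/matrixP => i j; have := H i j; rewrite !mxE => /intr_inj.
exists (\row_i c i); split; first by apply: inj; rewrite yE uc map_mxM.
move=> c' yE'; apply: inj; rewrite -uc.
by apply: (row_free_inj (approx_mx_free k.+1 (ltnW ltsN))); rewrite -yE yE' map_mxM.
Qed.

Lemma height_approx_space k s : (s < N)%N ->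
  height (approx_space k.+1 s) = norm2 (wedge (real_mx (approx_mx k.+1 s))).
Proof.
move=> ltsN; have [ratB dB] := approx_space_rational k.+1 (ltnW ltsN).
by apply: height_Zbasis => //; apply: approx_mx_Zbasis.
Qed.

(** The minor on the pivot columns attains the bound. *)
Lemma height_approx_space_ge k s : (s < N)%N -> D k.+1 <= height (approx_space k.+1 s).
Proof.
move=> ltsN; rewrite height_approx_space //; apply: le_trans (minor_le_norm2 _ (pivot_ord k.+1 (s := s))).
rewrite /minor -det_tr det_trig.
  rewrite big_ord_recl !mxE pivot_ordE trunc_entry0 big1 => [|i _].
    by rewrite mulr1 -natrX normr_nat.
  by rewrite !mxE /= pivot_ordE /= eqxx.
apply/is_trig_mxP => i j ltij; rewrite !mxE -(inj_eq val_inj) /= gtn_eqF ?(leq_ltn_trans _ ltij) //.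
rewrite pivot_ordE; case: eqP => // /(pivot_inj (ltnW ltsN)) eqij.
by rewrite eqij ltnn in ltij.
Qed.

Definition height_const s : R := #|multi_index (s + r).+1 n|%:R * ((s + r).+1)`!%:R.

(** Only the first row has large entries, and it contributes a single factor to
    each term of the Leibniz formula. *)
Lemma height_approx_space_le k s : (s < N)%N -> height (approx_space k.+1 s) <= height_const s * D k.+1.
Proof.
move=> ltsN; rewrite height_approx_space // /height_const -mulrA; apply: norm2_le => I.
rewrite /wedge ffunE -/(minor _ _) minor_map -intr_norm /minor.
apply: (@le_trans _ _ ((((s + r).+1)`!)%:R * (2 ^ a k.+1)%:R)); last by rewrite natrX.
rewrite -natrM -[leRHS]/((_ : nat)%:Z%:~R) ler_int.
apply: le_trans (ler_norm_sum _ _ _) _.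
apply: (@le_trans _ _ (\sum_(p : 'S_(s + r).+1) (2 ^ a k.+1)%N%:Z)); last first.
  by rewrite sumr_const card_Sn -mulr_natr natz -PoszM mulnC.
apply: ler_sum => p _; rewrite normrM normrX normrN1 expr1n mul1r normr_prod.
rewrite big_ord_recl -[leRHS]mulr1; apply: ler_pM => //.
- by apply: prodr_ge0.
- rewrite !mxE /= ger0_norm // lez_nat.
  by apply: leq_trans (trunc_entry_le _ _); apply: leq_addr.
- apply: (@proj2 (0 <= \prod_(i < s + r) `|(colsub (tnth (val I)) (approx_mx k.+1 s)) (lift ord0 i) (p (lift ord0 i))|)).
  apply: (big_ind (fun z : int => 0 <= z /\ z <= 1)) => // [z z' [z0 z1] [z'0 z'1]|i _].
    by split; [apply: mulr_ge0 | rewrite -[leRHS]mulr1; apply: ler_pM].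
  by rewrite !mxE /=; case: (_ == _).
Qed.

Lemma truncation_xi k : enorm (real_mx (truncation k) - D k *: xi_vec) <= n%:R * (2 * D k / D k.+1).
Proof.
apply: enorm_le => c; rewrite !mxE.
have -> : (trunc_entry k c)%:~R = D k * partial_sum k c :> R.
  by rewrite /partial_sum mulrC divfK ?gt_eqF ?D_gt0 // pmulrn.
rewrite -mulrBr normrM (gtr0_norm (D_gt0 k)) [2 * _]mulrC -mulrA.
apply: ler_wpM2l; first exact/ltW/D_gt0.
have := xi_ge c k; have := xi_le c k; rewrite ler_norml => h1 h2.
by apply/andP; split; lra.
Qed.

Lemma enorm_unit_vec c : enorm (real_mx (unit_vec c)) <= n%:R.
Proof.
rewrite -[leRHS]mulr1; apply: enorm_le => j; rewrite !mxE.
by case: (_ == _) => /=; rewrite ?normr1 ?normr0.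
Qed.

Lemma enorm_xi : enorm xi_vec <= n%:R.
Proof. by rewrite -[leRHS]mulr1; apply: enorm_le => j; rewrite mxE xi_bound. Qed.

(** Covers the at most 2n terms of a Laplace expansion, the norms of xi and of
    the basis vectors, bounded by n, and a margin for adding two errors. *)
Definition forcing_const : R := 8 * n%:R ^+ 3.

(** * Integer points forced into a close rational subspace *)

Section Forced.
Variables (e : nat) (Z : 'M[int]_(e, n)) (delta : R).
Hypothesis e_le : (e <= n)%N.
Hypothesis Zfree : row_free (real_mx Z).
Hypothesis delta_ge0 : 0 <= delta.
Let H := norm2 (wedge (real_mx Z)).
Hypothesis close : forall v, v \in target ->
  exists2 b, b \in row_space (real_mx Z) & enorm (v - b) <= delta * enorm v.

Let n1 : 1 <= n%:R :> R. Proof. by rewrite ler1n. Qed.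
Let n3 : n%:R * n%:R <= n%:R * (n%:R * n%:R) :> R.
Proof.
rewrite -subr_ge0 (_ : _ - _ = n%:R * n%:R * (n%:R - 1)); last by ring.
by rewrite !mulr_ge0 ?ler0n // subr_ge0.
Qed.
Let H_ge0 : 0 <= H. Proof. exact: norm2_ge0. Qed.
Let e1 : e.+1%:R <= 2 * n%:R :> R.
Proof. by rewrite -natrM ler_nat; lia. Qed.

Lemma forced_point (y : 'rV[int]_n) (v : 'rV[R]_n) eps : v \in target ->
  enorm (real_mx y - v) <= eps ->
  2 * n%:R * (eps + delta * enorm v) * H < 1 ->
  real_mx y \in row_space (real_mx Z).
Proof.
move=> vA yv small; have [b bB vb] := close vA.
rewrite mem_row_space; rewrite mem_row_space in bB; apply: (int_point_criterion Zfree bB).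
apply: le_lt_trans small; apply: ler_wpM2r; first exact: H_ge0.
apply: ler_pM; rewrite ?ler0n ?enorm_ge0 //.
rewrite (_ : _ - b = (real_mx y - v) + (v - b)); last by rewrite addrA subrK.
by apply: le_trans (enormD _ _) _; apply: lerD.
Qed.

Lemma forced_unit_vec i : (0 < i <= r)%N -> forcing_const * (H * delta) < 1 ->
  real_mx (unit_vec (N + i)) \in row_space (real_mx Z).
Proof.
move=> ir small; apply: (@forced_point _ (real_mx (unit_vec (N + i))) 0).
- exact: unit_vec_in_target.
- by rewrite subrr (eqP (_ : enorm 0 == 0)) ?enorm_eq0.
- rewrite add0r; apply: le_lt_trans small.
  rewrite /forcing_const [H * _]mulrC !mulrA; apply: ler_wpM2r => //.
  have := enorm_unit_vec (N + i); set w := enorm _ => wn.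
  have w0 : 0 <= w by exact: enorm_ge0.
  rewrite mulrAC; apply: ler_wpM2r => //.
  have : n%:R * w <= n%:R * n%:R :> R by rewrite ler_pM2l // (lt_le_trans ltr01).
  move: n3; rewrite -!mulrA; set t := n%:R; nra.
Qed.

Lemma forced_truncation k : forcing_const * H * D k < D k.+1 ->
  forcing_const * (H * delta) * D k < 1 -> real_mx (truncation k) \in row_space (real_mx Z).
Proof.
move=> small1 small2.
apply: (@forced_point _ (D k *: xi_vec) (n%:R * (2 * D k / D k.+1))).
- by rewrite memvZ ?xi_in_target.
- exact: truncation_xi.
- rewrite enormZ (gtr0_norm (D_gt0 k)).
  have h1 : forcing_const * H * (D k / D k.+1) < 1.
    by rewrite mulrA ltr_pdivrMr ?D_gt0 // mul1r.
  have D0 := D_gt0 k; have D1 := D_gt0 k.+1.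
  have q0 : 0 <= D k / D k.+1 by rewrite divr_ge0 // ltW.
  have xn := enorm_xi; move: q0 h1 small2; rewrite -!mulrA [2 * (D k / _)]mulrC.
  rewrite /forcing_const.
  set q := D k / D k.+1; set t := n%:R; set w := enorm xi_vec.
  move=> q0 h1 h2.
  have t1 : 1 <= t := n1.
  have w0 : 0 <= w by exact: enorm_ge0.
  have HD : 0 <= H * (delta * D k) by rewrite !mulr_ge0 // ltW.
  have Hq : 0 <= H * q by rewrite mulr_ge0.
  have tt : t * t <= t * (t * t) := n3.
  have tw : t * w <= t * (t * t) by apply: le_trans tt; rewrite ler_wpM2l // (le_trans ler01).
  have b1 : (t * t) * (H * q) <= (t * (t * t)) * (H * q) by apply: ler_wpM2r.
  have b2 : (t * w) * (H * (delta * D k)) <= (t * (t * t)) * (H * (delta * D k)) by apply: ler_wpM2r.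
  rewrite (_ : 2 * _ = 4 * ((t * t) * (H * q)) + 2 * ((t * w) * (H * (delta * D k)))); last by ring.
  rewrite (_ : 8 * _ = 8 * ((t * (t * t)) * (H * q))) in h1; last by ring.
  rewrite (_ : 8 * _ = 8 * ((t * (t * t)) * (H * (delta * D k)))) in h2; last by ring.
  lra.
Qed.

End Forced.

(** A digit vector is a combination of two consecutive truncations. *)
Lemma approx_space_sub (B : {vspace 'rV[R]_n}) k s :
  (forall i, (0 < i <= r)%N -> real_mx (unit_vec (N + i)) \in B) ->
  (forall j, (j <= s)%N -> real_mx (truncation (k + j)) \in B) -> (approx_space k s <= B)%VS.
Proof.
move=> uB tB; apply/span_subvP => v /tnthP [i ->]; rewrite tnth_mktuple.
have [i0|i0] := posnP i.
  have := tB 0%N (leq0n _); rewrite addn0; congr (_ \in B).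
  apply/rowP => c; rewrite !mxE (_ : i == 0) //; exact/eqP/val_inj.
have rowE : row i (real_mx (approx_mx k s)) = real_mx (unit_vec (pivot k s i)).
  by apply/rowP => c; rewrite !mxE -(inj_eq val_inj) /= gtn_eqF.
rewrite rowE /pivot gtn_eqF //; case: (leqP i s) => lis; last first.
  by apply: uB; have := ltn_ord i; lia.
have eqi : (k + i = (k + i.-1).+1)%N by lia.
rewrite eqi (_ : unit_vec _ =
    truncation (k + i.-1).+1 - (2 ^ (a (k + i.-1).+1 - a (k + i.-1)))%:Z *: truncation (k + i.-1)).
  by rewrite -eqi map_mxB map_mxZ memvB ?memvZ ?tB //; lia.
by rewrite truncationS addrC addKr.
Qed.

Lemma a_gt k : (k < a k)%N.
Proof. by elim: k => // k IH; have := a_lt k; lia. Qed.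

Lemma D_ratio (C : R) k : C < k%:R -> C * D k < D k.+1.
Proof.
move=> Ck; rewrite -(subnK (ltnW (a_lt k))) exprD ltr_pM2r ?D_gt0 //.
apply: lt_le_trans Ck _; rewrite -natrX ler_nat.
have h : (k <= a k.+1 - a k)%N by have := a_growth k; have := a_gt k; lia.
by apply: leq_trans h _; apply/ltnW/ltn_expl.
Qed.

(** A rational subspace containing A has distance 0 to A, so all truncations of
    large index lie in it. N + 1 consecutive ones and the last r basis vectors
    span the whole space. *)
Lemma target_not_in_rational e (B : {vspace 'rV[R]_n}) : (e < n)%N -> rational_subspaces e B -> ~ (target <= B)%VS.
Proof.
move=> lte [ratB dB] AB; have [Z Zfree ZB] := rational_int_basis ratB dB.
pose H := norm2 (wedge (real_mx Z)).
have close v : v \in target -> exists2 b, b \in row_space (real_mx Z) & enorm (v - b) <= 0 * enorm v.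
  move=> vA; exists v; first by rewrite ZB; apply: (subvP AB).
  by rewrite mul0r subrr (eqP (_ : enorm 0 == 0)) ?enorm_eq0.
pose k0 := (Num.trunc (forcing_const * H)).+1.
have : (approx_space k0 N <= B)%VS.
  apply: approx_space_sub => [i ir|j lej].
    by apply: (subvP AB); apply: unit_vec_in_target.
  rewrite -ZB; apply: (forced_truncation (ltnW lte) Zfree (lexx 0) close).
    apply: D_ratio; apply: lt_le_trans (truncnS_gt _) _.
    by rewrite ler_nat leq_addr.
  by rewrite mulr0 mulr0 mul0r ltr01.
by move=> /dimvS; rewrite dim_approx_space // dB leqNgt lte.
Qed.

Lemma truncation_in_approx_space k s j : (s <= N)%N -> (j <= s)%N -> real_mx (truncation (k + j)) \in approx_space k s.
Proof.
move=> lesN; elim: j => [|j IH] les.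
  rewrite addn0 mem_row_space (_ : real_mx _ = row 0 (real_mx (approx_mx k s))) ?row_sub //.
  by apply/rowP => c; rewrite !mxE.
rewrite addnS truncationS map_mxD map_mxZ memvD ?memvZ ?IH //; first lia.
have lt : (j.+1 < (s + r).+1)%N by lia.
rewrite mem_row_space (_ : real_mx _ = row (Ordinal lt) (real_mx (approx_mx k s))) ?row_sub //.
by apply/rowP => c; rewrite !mxE -(inj_eq val_inj) /= /pivot /= les addnS.
Qed.

Lemma unit_vec_in_approx_space k s i : (0 < i <= r)%N -> real_mx (unit_vec (N + i)) \in approx_space k s.
Proof.
move=> /andP [i0 ler]; have lt : (s + i < (s + r).+1)%N by lia.
rewrite mem_row_space (_ : real_mx _ = row (Ordinal lt) (real_mx (approx_mx k s))) ?row_sub //.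
apply/rowP => c; rewrite !mxE -(inj_eq val_inj) /= addn_eq0 (gtn_eqF i0) andbF /pivot.
rewrite addn_eq0 (gtn_eqF i0) andbF ifN; first by rewrite addKn.
by rewrite -ltnNge -[X in (X < _)%N]addn0 ltn_add2l.
Qed.

(** The truncation of index k + s approximates xi up to the first omitted digit. *)
Lemma target_close_to_approx_space k s v : (s <= N)%N -> v \in target ->
  exists2 b, b \in approx_space k s & enorm (v - b) <= 2 * n%:R / D (k + s).+1 * enorm v.
Proof.
move=> lesN /target_decomposition [w vE]; have D0 := D_gt0 (k + s).
exists ((v 0 0 / D (k + s)) *: real_mx (truncation (k + s)) + \sum_(i < r) w 0 i *: real_mx (unit_vec (N + i.+1))).
  apply: memvD; first by rewrite memvZ // truncation_in_approx_space.
  by apply: memv_suml => i _; rewrite memvZ // unit_vec_in_approx_space //=.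
rewrite {1}vE opprD addrACA subrr addr0.
rewrite (_ : _ - _ = - (v 0 0 / D (k + s)) *: (real_mx (truncation (k + s)) - D (k + s) *: xi_vec)); last first.
  by rewrite scalerBr scalerA mulNr divfK ?gt_eqF // !scaleNr opprK addrC.
rewrite enormZ normrN normrM normfV (gtr0_norm D0).
have h := truncation_xi (k + s); have v0 := coord_le_enorm v 0.
apply: le_trans (_ : `|v 0 0| * (2 * n%:R / D (k + s).+1) <= _); last first.
  rewrite [leRHS]mulrC; apply: ler_wpM2r => //.
rewrite -[leLHS]mulrA; apply: ler_wpM2l => //; rewrite ler_pdivrMl //; apply: le_trans h _.
by rewrite le_eqVlt; apply/orP; left; apply/eqP; field; rewrite gt_eqF ?D_gt0.
Qed.

(** The digit of index k + s + 1 is the first one to fall in a column where the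
    subspace imposes a relation: there the coordinate of each of its vectors is
    [partial_sum k] times coordinate 0, while xi has one more digit. *)
Lemma xi_far_from_approx_space k s b : (s < N)%N -> b \in approx_space k s ->
  1 / D (k + s.+1) <= 2 * enorm (xi_vec - b).
Proof.
move=> ltsN; rewrite mem_row_space => /submxP [u bE].
have lt : (digit_col (k + s.+1) < n)%N by have := digit_col_le (k + s.+1); lia.
pose c := Ordinal lt.
have b0 : b 0 0 = u 0 0 * D k by rewrite bE mul_approx_mx0.
have bc : b 0 c = b 0 0 * partial_sum k c.
  rewrite bE mul_approx_mx_out -?bE ?b0; last by move=> i; apply: pivot_neq_next_digit_col.
  by rewrite /partial_sum; field; rewrite gt_eqF ?D_gt0.
have x01 : 0 <= partial_sum k c <= 1.
  rewrite /partial_sum divr_ge0 ?ler0n ?(ltW (D_gt0 _)) //= ler_pdivrMr ?D_gt0 // mul1r -natrX ler_nat.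
  by apply: leq_trans (trunc_entry_le k c); rewrite leq_addr.
apply: le_trans (@xi_ge_digit k (k + s.+1) _) _; first by rewrite -addSnnS ltnS leq_addr.
have hc := coord_le_enorm (xi_vec - b) c; have h0 := coord_le_enorm (xi_vec - b) 0.
rewrite !mxE /= xi0 in hc h0; rewrite bc in hc.
rewrite (_ : xi _ - partial_sum k _ = (xi c - b 0 0 * partial_sum k c) - (1 - b 0 0) * partial_sum k c); last by rewrite /=; ring.
apply: le_trans (ler_norm _) _; apply: le_trans (ler_normB _ _) _.
rewrite normrM mulr2n mulrDl mul1r; apply: lerD => //.
case/andP: x01 => x0' x1; rewrite (ger0_norm x0').
by apply: le_trans h0; rewrite ler_piMr.
Qed.

(** * Values of the exponents *)

Section ExponentValue.
(* The upper limit of a_(k+s+1) / a_k is P. The bound Q on a_(k+s) / a_k, smaller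
   by a factor 4, is what forces the truncation of index k + s into the
   subspaces close to A. *)
Variables (s : nat) (P Q c : R).
Hypothesis ltsN : (s < N)%N.
Hypothesis Q_ge1 : 1 <= Q.
Hypothesis PQ : 4 * Q <= P.
Hypothesis a_upper : forall k, (a (k + s.+1))%:R <= P * (a k)%:R + c.
Hypothesis a_upper' : forall k, (a (k + s))%:R <= Q * (a k)%:R + c.
Hypothesis a_lower : forall k0, exists2 k, (k0 <= k)%N & P * (a k)%:R - c <= (a (k + s.+1))%:R.

Local Notation e := (s + r).+1.
Local Notation approximants mu := [set B : {vspace 'rV[R]_n} |
  rational_subspaces e B /\ omega_nth r.+1 target B <= height B `^ (- mu)].

Lemma approximants_infinite mu : 0 < mu -> mu < P -> infinite_set (approximants mu).
Proof.
move=> mu0 muP fin.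
have [M HM] := finite_bounded (@height R n) fin.
pose C1 : R := r.+1%:R * (2 * n%:R); pose C2 : R := height_const s.
have C1_gt0 : 0 < C1 by rewrite !mulr_gt0 // ltr0n.
have height_gt0 k : 0 < height (approx_space k.+1 s).
  exact: lt_le_trans (D_gt0 _) (height_approx_space_ge _ ltsN).
have C2_gt0 : 0 < C2.
  have := lt_le_trans (height_gt0 0%N) (height_approx_space_le 0 ltsN).
  by rewrite pmulr_lgt0 ?D_gt0.
have [K1 HK1] := large_nat M.
have [K2 HK2] := large_nat ((log2 C1 + c + mu * log2 C2) / (P - mu)).
have [k lek Hk] := a_lower (maxn K1 K2).+1.
have ak := a_gt k.
case: k lek Hk ak => // k; rewrite ltnS geq_max => /andP [le1 le2] Hk ak.
pose B := approx_space k.+1 s.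
have ratB : rational_subspaces e B by apply: approx_space_rational; apply: ltnW.
suff : approximants mu B.
  move/HM; apply/negP; rewrite -ltNge.
  apply: lt_le_trans (height_approx_space_ge _ ltsN).
  apply: lt_le_trans HK1 _; rewrite -natrX ler_nat.
  apply: leq_trans le1 _; apply: leq_trans (ltnW (ltn_expl k (isT : (1 < 2)%N))) _.
  by rewrite leq_exp2l // ltnW // ltnW.
split=> //.
have dB : \dim B = e by have [_ ->] := ratB.
have HB0 : 0 < height B := height_gt0 k.
apply: le_trans (omega_last_le dim_target _ (fun v vA => target_close_to_approx_space k.+1 (ltnW ltsN) vA)) _.
  by rewrite dim_target dB ltnS leq_addl.
rewrite mulrA -/C1 -ler_log2 ?powR_gt0 ?divr_gt0 ?D_gt0 //.
rewrite log2M ?invr_gt0 ?D_gt0 // log2V ?D_gt0 // log2_2X log2_powR -addnS.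
have : log2 (height B) <= log2 C2 + (a k.+1)%:R.
  rewrite -(log2_2X R (a k.+1)) -log2M ?D_gt0 // ler_log2 //; first exact: (height_approx_space_le k ltsN).
  exact: (mulr_gt0 C2_gt0 (D_gt0 _)).
move=> /(ler_wpM2l (ltW mu0)) hB.
have : (log2 C1 + c + mu * log2 C2) < (P - mu) * (a k.+1)%:R.
  rewrite [ltRHS]mulrC -ltr_pdivrMr ?subr_gt0 //; apply: lt_le_trans HK2 _.
  by rewrite ler_nat; lia.
lra.
Qed.

(** Without a Z-basis the height would be 0, the angle would vanish, and A would
    be contained in B. *)
Lemma approximants_height mu B : 0 < mu -> approximants mu B -> exists Z : 'M[int]_(e, n),
  [/\ row_free (real_mx Z), row_space (real_mx Z) = B & height B = norm2 (wedge (real_mx Z))].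
Proof.
move=> mu0 [ratB close]; case: (height_cases (isT : (0 < e)%N) ratB) => // H0.
have dB : \dim B = e by have [_ ->] := ratB.
case: (@target_not_in_rational e B) => //; first by lia.
apply/subvP => v vA.
have [|b bB] := omega_last_close dim_target (B := B) _ vA.
  by rewrite dim_target dB ltnS leq_addl.
have -> : omega_nth r.+1 target B = 0.
  apply/eqP; rewrite eq_le; apply/andP; split; last by rewrite omega_nthE omega_ge0.
  by apply: le_trans close _; rewrite H0 powR0 // oppr_eq0 gt_eqF.
rewrite mulr0 mul0r => h; have : enorm (v - b) == 0 by rewrite eq_le h enorm_ge0.
by rewrite enorm_eq0 subr_eq0 => /eqP ->.
Qed.

(** The gaps a_(k+1) - a_k do not decrease. *)
Lemma D_ratio_mono (C : R) k j : 0 <= C -> C * D k < D k.+1 -> C * D (k + j) < D (k + j).+1.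
Proof.
move=> C0 h; elim: j => [|j IH]; first by rewrite addn0.
rewrite addnS; set i := (k + j)%N in IH *.
have lei := a_lt i; have lei' := a_lt i.+1.
rewrite -(subnK (ltnW lei)) -(subnK (ltnW lei')) !exprD.
have : (a i.+1 - a i <= a i.+2 - a i.+1)%N.
  by have := a_growth i.+1; have := a_pos i; lia.
move=> /(ler_weXn2l (ler1n R 2)) hh.
apply: lt_le_trans (_ : 2 ^+ (a i.+1 - a i) * D i.+1 <= _); last by rewrite ler_pM2r ?D_gt0.
by rewrite mulrCA ltr_pM2l ?exprn_gt0.
Qed.

(** If infinitely many subspaces were this close, some of them would have
    arbitrarily large height H. Take k minimal such that 2^(a_(k+1) - a_k) exceeds
    a constant times H. Then the truncations of index k, ..., k + s lie in B:
    the choice of k controls their distance to A, and mu > P controls the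
    distance from A to B. Hence B = [approx_space k s], and comparing
    H >= 2^(a_k) with the distance 2^(-a_(k+s+1)) contradicts mu > P. *)
Lemma approximants_finite mu : P < mu -> ~ infinite_set (approximants mu).
Proof.
move=> Pmu; apply.
have Q1 := Q_ge1; have PQ' := PQ; have P0 : 0 < P by lra.
have mu0 : 0 < mu by lra.
pose C : R := forcing_const * r.+1%:R.
have n1 : 1 <= n%:R :> R by rewrite ler1n.
have forcing_const_ge1 : 1 <= forcing_const.
  have : 1 <= n%:R ^+ 3 :> R by rewrite exprn_ege1.
  by rewrite /forcing_const; lra.
have C_ge1 : 1 <= C by rewrite mulr_ege1 // ler1n.
pose lC := log2 C.
have lC0 : 0 <= lC by rewrite -log2_1 ler_log2 // (lt_le_trans ltr01).
pose C' : R := 2 * n%:R * r.+1%:R.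
have C'_gt0 : 0 < C' by rewrite !mulr_gt0 // ltr0n.
have [K1 HK1] := large_nat (lC + c + 3 * Q * lC).
have [K2 HK2] := large_nat ((log2 C' + c) / (mu - P)).
(* Beyond index K the terms in a_k dominate all constants below. *)
pose K := maxn K1 K2.
apply: sub_finite_set (@finite_bounded_height R n e (D K.+1)).
move=> B AB; have [Z [Zfree ZB HB]] := approximants_height mu0 AB.
exists Z; split=> //; rewrite -HB leNgt; apply/negP => Hbig.
have H_gt0 : 0 < height B by apply: lt_trans Hbig; apply: D_gt0.
pose h := log2 (height B).
have [[ratB dB] close] := AB.
pose delta := r.+1%:R * height B `^ (- mu).
have delta_gt0 : 0 < delta by rewrite mulr_gt0 ?ltr0n ?powR_gt0.
have ldelta : log2 delta = log2 r.+1%:R - mu * h.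
  by rewrite /delta log2M ?ltr0n ?powR_gt0 // log2_powR mulNr.
have closeZ v : v \in target -> exists2 b, b \in row_space (real_mx Z) & enorm (v - b) <= delta * enorm v.
  move=> vA; have [|b bB vb] := omega_last_close dim_target (B := B) _ vA.
    by rewrite dim_target dB ltnS leq_addl.
  exists b; first by rewrite ZB.
  apply: le_trans vb _; rewrite ler_wpM2r ?enorm_ge0 // /delta ler_wpM2l //.
have forcing_const_gt0 : 0 < forcing_const by apply: lt_le_trans forcing_const_ge1.
have cH : 0 < forcing_const * height B by rewrite mulr_gt0.
have exk : exists k, forcing_const * height B * D k < D k.+1.
  have [k hk] := large_nat (forcing_const * height B); exists k; exact: D_ratio.
case: (ex_minnP exk) => k Hk mink.
have ltKk : (K < k)%N.
  rewrite ltnNge; apply/negP => lekK.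
  have : D k.+1 <= D K.+1.
    rewrite ler_weXn2l ?ler1n //; apply: (@homo_leq _ a leq) => //.
    - exact: leq_trans.
    - by move=> i; apply/ltnW/a_lt.
  apply/negP; rewrite -ltNge; apply: lt_le_trans Hbig _.
  apply: le_trans (ltW Hk); rewrite mulrAC ler_peMl ?(ltW H_gt0) //.
  by rewrite mulr_ege1 // exprn_ege1 // ler1n.
have ak := a_gt k.
case: k ltKk Hk mink ak => // k ltKk Hk mink ak.
have lgcrit : log2 forcing_const <= lC by rewrite ler_log2 ?(lt_le_trans ltr01) // ler_peMr ?ler1n // ltW.
(* Minimality of k. With a_k <= a_(k+1) / 3 it bounds h from below. *)
have low : (a k.+1)%:R <= lC + h + (a k)%:R.
  have : ~~ (forcing_const * height B * D k < D k.+1).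
    by apply/negP => /mink; rewrite ltnn.
  rewrite -leNgt -ler_log2 ?D_gt0 //; last exact: mulr_gt0 cH (D_gt0 _).
  rewrite (log2M cH (D_gt0 _)) (log2M forcing_const_gt0 H_gt0) !log2_2X -/h; lra.
have h_low : 2 * (a k.+1)%:R <= 3 * (lC + h).
  have : (3 * a k <= a k.+1)%N := a_growth k.
  by rewrite -(ler_nat R) natrM; lra.
have aK : K%:R + 1 <= (a k.+1)%:R :> R by rewrite natr1 ler_nat (ltn_trans ltKk ak).
have K1K : K1%:R <= K%:R :> R by rewrite ler_nat leq_maxl.
have K2K : K2%:R <= K%:R :> R by rewrite ler_nat leq_maxr.
have h0 : 0 <= h.
  rewrite -log2_1 ler_log2 //; by apply: le_trans (ltW Hbig); rewrite exprn_ege1 // ler1n.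
(* Here 4 Q <= P is used: mu - 1 >= 3 Q, and 3 h is about 2 a_k or more, so mu h
   exceeds h + a_(k+s) by about Q a_k. *)
have expo : lC + h - mu * h + (a (k.+1 + s))%:R < 0.
  have h1 : 3 * Q * h <= (mu - 1) * h by apply: ler_wpM2r => //; lra.
  have h2 : Q * (2 * (a k.+1)%:R) <= Q * (3 * (lC + h)) by apply: ler_wpM2l => //; lra.
  have h3 : (a k.+1)%:R <= Q * (a k.+1)%:R by rewrite ler_peMl.
  have := a_upper' k.+1; lra.
have Hd : 0 < height B * delta by exact: mulr_gt0.
have cHd : 0 < forcing_const * (height B * delta) by exact: mulr_gt0.
have small j : (j <= s)%N -> forcing_const * (height B * delta) * D (k.+1 + j) < 1.
  move=> les.
  have : D (k.+1 + j) <= D (k.+1 + s).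
    rewrite ler_weXn2l ?ler1n //; apply: (@homo_leq _ a leq); rewrite ?leq_add2l //.
    - exact: leq_trans.
    - by move=> i; apply/ltnW/a_lt.
  move=> hD; apply: le_lt_trans (_ : forcing_const * (height B * delta) * D (k.+1 + s) < 1).
    by apply: ler_wpM2l => //; exact: ltW.
  rewrite -ltr_log2 //; last exact: mulr_gt0 cHd (D_gt0 _).
  rewrite (log2M cHd (D_gt0 _)) (log2M forcing_const_gt0 Hd) (log2M H_gt0 delta_gt0) log2_2X log2_1 ldelta -/h.
  move: expo; rewrite /lC /C (log2M forcing_const_gt0 (ltr0Sn _ r)); lra.
have le_en : (e <= n)%N by rewrite ltnS leq_add2r ltnW.
have sub : (approx_space k.+1 s <= B)%VS.
  rewrite HB in Hk small.
  rewrite -ZB; apply: approx_space_sub => [i ir|j lej].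
    apply: (forced_unit_vec le_en Zfree (ltW delta_gt0) closeZ ir).
    apply: le_lt_trans (small 0%N (leq0n _)).
    rewrite ler_peMr //; last by rewrite exprn_ege1 // ler1n.
    by rewrite mulr_ge0 ?(ltW forcing_const_gt0) // mulr_ge0 ?(ltW delta_gt0) // norm2_ge0.
  apply: (forced_truncation le_en Zfree (ltW delta_gt0) closeZ); last exact: small.
  by apply: D_ratio_mono => //; rewrite mulr_ge0 ?norm2_ge0 // ltW.
have BE : approx_space k.+1 s = B.
  by apply/eqP; rewrite eqEdim sub dim_approx_space ?(ltnW ltsN) // dB leqnn.
have hge : (a k.+1)%:R <= h.
  rewrite -(log2_2X R (a k.+1)) ler_log2 ?D_gt0 // -BE; exact: (height_approx_space_ge k ltsN).
have [b bB xb] := closeZ _ xi_in_target; rewrite ZB -BE in bB.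
have far := xi_far_from_approx_space ltsN bB.
have : 1 / D (k.+1 + s.+1) <= C' * height B `^ (- mu).
  apply: le_trans far _; rewrite /C' -!mulrA ler_wpM2l //.
  apply: le_trans xb _; rewrite mulrC; apply: ler_wpM2r; first exact: ltW.
  exact: enorm_xi.
have Hmu : 0 < height B `^ (- mu) by exact: powR_gt0.
rewrite div1r -ler_log2 ?invr_gt0 ?D_gt0 //; last exact: mulr_gt0.
rewrite (log2M C'_gt0 Hmu) log2V ?D_gt0 // log2_2X log2_powR -/h => fin1.
have muh : mu * (a k.+1)%:R <= mu * h by apply: ler_wpM2l => //; exact: ltW.
have : log2 C' + c < (mu - P) * (a k.+1)%:R.
  rewrite [ltRHS]mulrC -ltr_pdivrMr ?subr_gt0 //; lra.
have := a_upper k.+1; lra.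
Qed.

(** The hypothesis on j says that psi_j is the sine of the largest angle. *)
Lemma exponent_value d j : d = r.+1 -> (j + gdim d e n = d)%N -> exponent e j target = P%:E.
Proof.
move=> dE jE; have Q1 := Q_ge1; have PQ' := PQ; have P0 : 0 < P by lra.
have approximantsE mu : [set B | rational_subspaces e B /\ psi j target B <= height B `^ (- mu)] = approximants mu.
  apply/seteqP; split=> B [ratB]; have [_ dB] := ratB.
    by rewrite /psi dim_target dB -dE jE dE.
  by move=> h; split=> //; rewrite /psi dim_target dB -dE jE dE.
apply/eqP; rewrite eq_le; apply/andP; split.
  apply: ge_ereal_sup => _ [->|[mu [mu0 inf_mu] <-]]; first by rewrite lee_fin ltW.
  rewrite lee_fin leNgt; apply/negP => Pmu; rewrite approximantsE in inf_mu.
  exact: (approximants_finite Pmu).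
rewrite leNgt; apply/negP => lt_sup.
have sup0 : (0 <= exponent e j target)%E by apply: ereal_sup_ubound; left.
have [q qE] : exists q : R, exponent e j target = q%:E.
  case: (exponent e j target) lt_sup sup0 => [q _ _|//|//]; by exists q.
rewrite qE lte_fin in lt_sup; rewrite qE lee_fin in sup0.
(* A value strictly between the supremum q and P. *)
pose mu := (q + P) / 2.
have mu0 : 0 < mu by rewrite /mu; lra.
have : (mu%:E <= exponent e j target)%E.
  apply: ereal_sup_ubound; right; exists mu => //; split=> //.
  by rewrite approximantsE; apply: approximants_infinite => //; rewrite /mu; lra.
by rewrite qE lee_fin /mu; lra.
Qed.

End ExponentValue.

Lemma target_irrational d e j : d = r.+1 -> (e < n)%N -> (j + gdim d e n = d)%N ->
  irrational_subspaces d e j target.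
Proof.
move=> dE lte jE; split=> [|B ratB]; first by rewrite dim_target.
rewrite jE dE ltnNge; apply/negP => le_cap; apply: (target_not_in_rational lte ratB).
have capA : (target :&: B)%VS = target.
  by apply/eqP; rewrite eqEdim capvSl dim_target.
by rewrite -capA capvSr.
Qed.

End Construction.

(** * Growth sequences and prescribed exponents *)

Section Growth.
Local Open Scope ring_scope.
Variables (R : realType) (N : nat) (alpha : nat -> R).
Hypothesis N_gt0 : (0 < N)%N.
Hypothesis alpha_ge4 : forall i, (i < N)%N -> 4 <= alpha i.
Hypothesis alpha_noninc : forall i j, (i <= j < N)%N -> alpha j <= alpha i.

Definition prefix_prod i : R := \prod_(0 <= l < i) alpha l.
Definition cyclic_prod k : R := \prod_(0 <= l < k) alpha (l %% N).
Definition growth_seq k : nat := Num.trunc (cyclic_prod k).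

Let alpha_ge0 i : (i < N)%N -> 0 <= alpha i.
Proof. by move=> lti; apply: le_trans (alpha_ge4 lti). Qed.

Let alpha_mod_ge4 i : 4 <= alpha (i %% N).
Proof. by apply: alpha_ge4; rewrite ltn_pmod. Qed.

Lemma cyclic_prodD k e :
  cyclic_prod (k + e) = cyclic_prod k * \prod_(0 <= l < e) alpha ((k + l) %% N).
Proof.
rewrite /cyclic_prod (@big_cat_nat _ _ _ k) ?leq_addr //=; congr (_ * _).
rewrite -{1}[k]add0n big_addn addKn.
by apply: eq_bigr => l _; rewrite addnC.
Qed.

(** A window of length at most N that does not wrap around is compared termwise
    with the initial one. If it wraps around, its wrapped part is an initial
    segment, and the other part is compared termwise with what remains. *)
Lemma window_le k e : (e <= N)%N ->
  \prod_(0 <= l < e) alpha ((k + l) %% N) <= prefix_prod e.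
Proof.
move=> leeN; set m := (k %% N)%N.
have ltmN : (m < N)%N by rewrite ltn_pmod.
rewrite (eq_bigr (fun l => alpha ((m + l) %% N))); last by move=> l _; rewrite modnDml.
have direct i t : (m + i <= N)%N -> (t <= m)%N ->
    \prod_(0 <= l < i) alpha ((m + l) %% N) <= \prod_(0 <= l < i) alpha (t + l).
  move=> lei let'; rewrite !big_nat; apply: ler_prod => l /andP [_ ltl].
  rewrite modn_small; last by lia.
  by rewrite alpha_ge0 ?alpha_noninc //=; lia.
case: (leqP (m + e) N) => [le_me|lt_Nme].
  by have := direct e 0%N le_me (leq0n _).
pose t := (N - m)%N; pose q := (e - t)%N.
have eE : e = (t + q)%N by rewrite /q /t; lia.
rewrite (@big_cat_nat _ _ _ t) //=; last by rewrite eE leq_addr.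
rewrite /prefix_prod [leRHS](@big_cat_nat _ _ _ q) //=; last exact: leq_subr.
rewrite mulrC; apply: ler_pM.
- by apply: prodr_ge0 => l _; apply: le_trans (alpha_mod_ge4 _).
- by apply: prodr_ge0 => l _; apply: le_trans (alpha_mod_ge4 _).
- rewrite -{1}[t]add0n big_addn -/q le_eqVlt; apply/orP; left; apply/eqP.
  rewrite !big_nat; apply: eq_bigr => l /andP [_ ltl]; congr alpha.
  rewrite addnCA (_ : (m + t = N)%N); last by rewrite /t; lia.
  by rewrite modnDr modn_small //; lia.
- rewrite -{1}[q]add0n big_addn.
  rewrite (_ : (e - q = t)%N); last by lia.
  rewrite [leRHS](eq_bigr (fun l => alpha (q + l))); last by move=> l _; rewrite addnC.
  by apply: direct; lia.
Qed.

Lemma cyclic_prod_le k e : (e <= N)%N -> cyclic_prod (k + e) <= prefix_prod e * cyclic_prod k.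
Proof.
move=> leeN; rewrite cyclic_prodD mulrC; apply: ler_wpM2r; last exact: window_le.
by apply: prodr_ge0 => l _; apply: le_trans (alpha_mod_ge4 _).
Qed.

Lemma cyclic_prod_mul q e : (e <= N)%N ->
  cyclic_prod (q * N + e) = prefix_prod e * cyclic_prod (q * N).
Proof.
move=> leeN; rewrite cyclic_prodD mulrC; congr (_ * _).
rewrite /prefix_prod !big_nat; apply: eq_bigr => l /andP [_ ltl].
by rewrite modnMDl modn_small //; lia.
Qed.

Lemma cyclic_prodS k : cyclic_prod k.+1 = cyclic_prod k * alpha (k %% N).
Proof. by rewrite /cyclic_prod big_nat_recr. Qed.

Lemma cyclic_prod_ge1 k : 1 <= cyclic_prod k.
Proof.
elim: k => [|k IH]; first by rewrite /cyclic_prod big_geq.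
by rewrite cyclic_prodS mulr_ege1 // (le_trans _ (alpha_mod_ge4 k)) // ler1n.
Qed.

Lemma growth_seq_le k : (growth_seq k)%:R <= cyclic_prod k.
Proof. by rewrite truncn_le ?(le_trans ler01 (cyclic_prod_ge1 k)). Qed.

Lemma growth_seq_gt k : cyclic_prod k < (growth_seq k)%:R + 1.
Proof. by rewrite natr1; apply: truncnS_gt. Qed.

Lemma growth_seq_gt0 : (0 < growth_seq 0)%N.
Proof.
have := growth_seq_gt 0; rewrite /cyclic_prod big_geq // natr1 ltr1n.
by [].
Qed.

Lemma growth_seqS k : (3 * growth_seq k <= growth_seq k.+1)%N.
Proof.
have h1 := growth_seq_gt k.+1; have h2 := growth_seq_le k; have h3 := cyclic_prod_ge1 k.
have h4 := alpha_mod_ge4 k; rewrite cyclic_prodS in h1.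
have h5 : cyclic_prod k * 4 <= cyclic_prod k * alpha (k %% N) by apply: ler_wpM2l => //; lra.
have : (4 * growth_seq k < growth_seq k.+1 + 1)%N.
  rewrite -(ltr_nat R) natrM natrD; lra.
lia.
Qed.

Lemma prefix_prodS s : prefix_prod s.+1 = prefix_prod s * alpha s.
Proof. by rewrite /prefix_prod big_nat_recr. Qed.

Lemma prefix_prod_ge1 s : (s <= N)%N -> 1 <= prefix_prod s.
Proof.
elim: s => [|s IH] les; first by rewrite /prefix_prod big_geq.
by rewrite prefix_prodS mulr_ege1 ?IH ?(ltnW les) // (le_trans _ (alpha_ge4 les)) // ler1n.
Qed.

Lemma growth_seq_upper s k : (s <= N)%N ->
  (growth_seq (k + s))%:R <= prefix_prod s * (growth_seq k)%:R + prefix_prod s.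
Proof.
move=> les; apply: le_trans (growth_seq_le _) _; apply: le_trans (cyclic_prod_le _ les) _.
rewrite -[X in _ + X]mulr1 -mulrDr; apply: ler_wpM2l; last exact/ltW/growth_seq_gt.
by apply: le_trans (prefix_prod_ge1 les).
Qed.

Lemma growth_seq_lower s k0 : (s <= N)%N -> exists2 k, (k0 <= k)%N &
  prefix_prod s * (growth_seq k)%:R - 1 <= (growth_seq (k + s))%:R.
Proof.
(* At multiples of the period the window starts at alpha_0, so that equality
   holds in [cyclic_prod_le]. *)
move=> les; exists (k0 * N)%N; first exact: leq_pmulr.
have := growth_seq_gt (k0 * N + s); rewrite cyclic_prod_mul //.
have := growth_seq_le (k0 * N); have h := prefix_prod_ge1 les.
have h0 : 0 <= prefix_prod s by apply: le_trans h.
move=> /(ler_wpM2l h0); lra.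
Qed.
End Growth.

(** * Prescribed exponents *)

Section Prescribed.
Local Open Scope ring_scope.
Variable R : realType.

Lemma gdimE d e n : (e <= n)%N -> (d - gdim d e n + gdim d e n)%N = d.
Proof. rewrite /gdim max0n; lia. Qed.

Lemma prescribed_exponents_aux N r (alpha : nat -> R) : (0 < N)%N ->
  (forall i, (i < N)%N -> 4 <= alpha i) ->
  (forall i j, (i <= j < N)%N -> alpha j <= alpha i) ->
  exists A : {vspace 'rV[R]_(N + r).+1},
    (forall e, (e < (N + r).+1)%N -> irrational_subspaces r.+1 e (r.+1 - gdim r.+1 e (N + r).+1) A) /\
    (forall i, (i < N)%N ->
      exponent (r.+1 + i) (r.+1 - gdim r.+1 (r.+1 + i) (N + r).+1) A = (prefix_prod alpha i.+1)%:E).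
Proof.
move=> N0 ge4 noninc; pose a := growth_seq N alpha.
have a0 : (0 < a 0)%N by apply: growth_seq_gt0.
have aS k : (3 * a k <= a k.+1)%N by apply: growth_seqS.
exists (target R N r a); split=> [e lte|i lti].
  by apply: target_irrational => //; rewrite gdimE // ltnW.
have PS := prefix_prodS alpha i; have Pi := prefix_prod_ge1 ge4 (ltnW lti).
have al := ge4 _ lti.
have P4 : 4 * prefix_prod alpha i <= prefix_prod alpha i.+1.
  by rewrite PS mulrC; apply: ler_wpM2l => //; lra.
have -> : (r.+1 + i = (i + r).+1)%N by lia.
apply: (@exponent_value R N r a N0 a0 aS i _ (prefix_prod alpha i) (prefix_prod alpha i.+1)) => //.
- by move=> k; apply: growth_seq_upper.
- move=> k; apply: le_trans (growth_seq_upper N0 ge4 noninc k (ltnW lti)) _.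
  by rewrite lerD2l; lra.
- move=> k0; have [k lek h] := growth_seq_lower N0 ge4 k0 lti.
  by exists k => //; rewrite -/a in h; lra.
- by rewrite gdimE //; lia.
Qed.

Lemma prescribed_exponents n d (alpha : nat -> R) : (0 < d < n)%N ->
  (forall i, (i < n - d)%N -> 4 <= alpha i) ->
  (forall i j, (i <= j < n - d)%N -> alpha j <= alpha i) ->
  exists A : {vspace 'rV[R]_n},
    (forall e, (e < n)%N -> irrational_subspaces d e (d - gdim d e n) A) /\
    (forall i, (i < n - d)%N ->
      exponent (d + i) (d - gdim d (d + i) n) A = (prefix_prod alpha i.+1)%:E).
Proof.
move=> /andP [d0 ltdn] ge4 noninc; set N := (n - d)%N in ge4 noninc *.
have N0 : (0 < N)%N by rewrite subn_gt0.
have : n = (N + d.-1).+1 by rewrite /N; lia.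
move: N N0 ge4 noninc => N N0 ge4 noninc nE; subst n.
by case: d d0 ltdn => // r _ _; apply: prescribed_exponents_aux.
Qed.

End Prescribed.

(** * An open set of vectors of exponents *)

Section Region.
Local Open Scope ring_scope.
Local Open Scope classical_set_scope.
Variable R : realType.

(** Coordinates indexed by natural numbers, so that a vector can serve as the
    sequence alpha; the value 1 outside the range is arbitrary. *)
Definition entry N (w : 'rV[R]_N) (j : nat) : R :=
  if insub j is Some l then w 0 l else 1.

Lemma entryE N (w : 'rV[R]_N) j (ltj : (j < N)%N) : entry w j = w 0 (Ordinal ltj).
Proof. by rewrite /entry insubT. Qed.

(** The inverse of the map from a sequence alpha to its initial products. *)
Definition ratios N (w : 'rV[R]_N) (i : nat) : R :=
  if i is j.+1 then entry w i / entry w j else entry w 0%N.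

Lemma prefix_prod_ratios N (w : 'rV[R]_N) (i : 'I_N) :
  (forall l, (l < N)%N -> 4 <= ratios w l) -> prefix_prod (ratios w) i.+1 = w 0 i.
Proof.
move=> ge4; case: i => i lti.
elim: i lti => [|i IH] lti; rewrite prefix_prodS.
  by rewrite /prefix_prod big_geq // mul1r /ratios entryE.
have ltiN : (i < N)%N by apply: ltnW.
have /= -> := IH ltiN; rewrite /= !entryE mulrC divfK //.
apply/eqP => wi0; have := ge4 _ lti.
by rewrite /ratios !entryE wi0 invr0 mulr0; apply/negP; rewrite -ltNge.
Qed.

Lemma entry_continuous N (p : 'rV[R]_N) (i : nat) : (i < N)%N ->
  {for p, continuous (fun w : 'rV[R]_N => entry w i)}.
Proof.
move=> lti; rewrite (_ : (fun w : 'rV[R]_N => _) = (fun w : 'rV[R]_N => w 0 (Ordinal lti))).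
  exact: coord_continuous.
by apply/funext => w; rewrite entryE.
Qed.

Lemma ratios_continuous N (p : 'rV[R]_N) (i : nat) : (i < N)%N ->
  (forall l, (l < N)%N -> entry p l != 0) ->
  {for p, continuous (fun w : 'rV[R]_N => ratios w i)}.
Proof.
move=> lti p0; case: i lti => [|i] lti; first exact: entry_continuous.
have ci := @entry_continuous _ p _ lti; have cj := @entry_continuous _ p _ (ltnW lti).
have cVj : {for p, continuous (fun w : 'rV[R]_N => (entry w i)^-1)}.
  by apply: (@continuousV _ _ (fun w : 'rV[R]_N => entry w i) p); [exact: p0 (ltnW lti) | exact: cj].
exact: (continuousM ci cVj).
Qed.

(** At the point whose ratios are 4 + N, ..., 5 all the inequalities are strict,
    and the ratios are continuous there. *)
Lemma ratios_region N : exists p : 'rV[R]_N, \forall w \near p,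
  (forall i, (i < N)%N -> 4 <= ratios w i) /\
  (forall i j, (i <= j < N)%N -> ratios w j <= ratios w i).
Proof.
(* Strictly decreasing and greater than 4 on 0, ..., N - 1. *)
pose q (i : nat) : R := (4 + N - i)%:R.
pose p : 'rV[R]_N := \row_i \prod_(0 <= l < i.+1) q l.
have q4 i : (i < N)%N -> 4 < q i by move=> lti; rewrite /q ltr_nat; lia.
have pE i : (i < N)%N -> entry p i = \prod_(0 <= l < i.+1) q l.
  by move=> lti; rewrite entryE mxE.
have p0 l : (l < N)%N -> entry p l != 0.
  move=> ltl; rewrite pE // gt_eqF // big_nat; apply: prodr_gt0 => i /andP [_ lti].
  by rewrite (lt_trans _ (q4 _ _)) // ?ltr0n // (leq_trans lti).
have pq i : (i < N)%N -> ratios p i = q i.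
  case: i => [|i] lti; first by rewrite /ratios pE // big_nat1.
  rewrite /ratios pE // pE ?(ltnW lti) // big_nat_recr //= mulrC mulKf //.
  by rewrite -pE ?p0 // ltnW.
exists p.
have near1 : \forall w \near p, forall i : 'I_N, 4 <= ratios w i.
  apply: (@filter_forall _ _ (fun (i : 'I_N) (w : 'rV[R]_N) => 4 <= ratios w i) (nbhs p)) => i.
  have := ratios_continuous (ltn_ord i) p0.
  move=> /cvgr_gt /(_ 4); rewrite pq // => /(_ (q4 _ (ltn_ord i))).
  by apply: filterS => w /ltW.
have near2 : \forall w \near p, forall ij : 'I_N * 'I_N, (ij.1 < ij.2)%N -> ratios w ij.2 <= ratios w ij.1.
  apply: (@filter_forall _ _ (fun (ij : 'I_N * 'I_N) (w : 'rV[R]_N) =>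
    (ij.1 < ij.2)%N -> ratios w ij.2 <= ratios w ij.1) (nbhs p)) => -[i j] /=.
  case: (ltnP i j) => [ltij|_]; last by apply: nearW.
  have ci := ratios_continuous (ltn_ord i) p0.
  have cj := ratios_continuous (ltn_ord j) p0.
  have pij : 0 < ratios p i - ratios p j.
    by rewrite !pq // subr_gt0 /q ltr_nat; have := ltn_ord j; lia.
  have := continuousB ci cj; move=> /cvgr_gt /(_ 0 pij).
  by apply: filterS => w /=; rewrite subr_gt0 => /ltW.
apply: filterS2 near1 near2 => w h1 h2; split=> [i lti|i j /andP [leij ltj]].
  exact: (h1 (Ordinal lti)).
move: leij; rewrite leq_eqVlt => /orP [/eqP -> //|ltij].
exact: (h2 (Ordinal (ltn_trans ltij ltj), Ordinal ltj)).
Qed.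
End Region.

(** * Submersions *)

Section Final.
Local Open Scope ring_scope.
Local Open Scope classical_set_scope.

(** Only the first derivative matters: it is zero at p, hence not onto. *)
Lemma submersion_not_locally_zero (R : realType) k (h : 'rV[R]_k -> R^o) (p : 'rV[R]_k) :
  submersion h -> ~ (\forall w \near p, h w = 0).
Proof.
move=> [smooth_h sur] h0; have [diff_h _] := smooth_h 1%N.
have dh0 v : 'd h p v = 0.
  rewrite -deriveE //; transitivity ('D_v (cst 0 : 'rV[R]_k -> R^o) p).
    by apply: near_eq_derive; apply: h0.
  by rewrite derive_cst.
have [v _ /=] := sur p 1 I; rewrite dh0 => /esym/eqP.
by rewrite oner_eq0.
Qed.
End Final.

Local Open Scope classical_set_scope.

Theorem theorem1p6 (R : realType) (n d : nat) (hn : (2 <= n)%N)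
    (hd : (1 <= d <= n - 1)%N) (hdn : (d %| n)%N) :
  smoothly_independent
    (\bigcap_(e in [set e : nat | (d <= e <= n - 1)%N])
        irrational_subspaces d e (d - gdim d e n))
    (fun (i : 'I_(n - d)) (A : {vspace 'rV[R]_n}) =>
        exponent (d + i) (d - gdim d (d + i) n) A).
Proof.
move=> [h [subm_h h_vanishes]].
have d_range : (0 < d < n)%N by lia.
have [p near_p] := ratios_region R (n - d).
apply: (@submersion_not_locally_zero _ _ h p subm_h).
apply: filterS near_p => w [ge4 noninc].
have [A [A_irr A_exp]] := prescribed_exponents d_range ge4 noninc.
have exp_w (i : 'I_(n - d)) : exponent (d + i) (d - gdim d (d + i) n) A = (w ord0 i)%:E.
  by rewrite A_exp // prefix_prod_ratios.
rewrite -(h_vanishes A).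
- by congr h; apply/rowP => i; rewrite mxE exp_w.
- by move=> e /= lee; apply: A_irr; lia.
- by move=> i; rewrite exp_w.
Qed.
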